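(* Every analytic map $\phi:B_E\to B_E$ induces a bounded composition operator $C_\phi:\mathcal B(B_E)\to \mathcal B(B_E)$, $C_\phi f=f\circ\phi$.
   Context: $E$ is a complex Hilbert space of arbitrary dimension with open unit ball $B_E$. The Bloch space $\mathcal B(B_E)$ is the space of analytic $f:B_E\to\mathbb C$ with $\|f\|_{\mathcal B(B_E)}=\sup_{x\in B_E}(1-\|x\|^2)\|f'(x)\|<\infty$, endowed with the norm $\|f\|_{Bloch(B_E)}=|f(0)|+\|f\|_{inv}$, where $\|f\|_{inv}=\sup_{x\in B_E}\|\nabla(f\circ\varphi_x)(0)\|$ is an equivalent seminorm; here $\nabla g(x)\in E$ is the vector with $g'(x)(y)=\langle y,\overline{\nabla g(x)}\rangle$ (conjugation taken coordinatewise in a fixed orthonormal basis), and $\varphi_a(y)=(s_aQ_a+P_a)\big(\frac{a-y}{1-\langle y,a\rangle}\big)$ is the Möbius automorphism of $B_E$, with $s_a=\sqrt{1-\|a\|^2}$, $P_a$ the orthogonal projection onto $\mathbb C a$ and $Q_a=I-P_a$. *)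

(* Defs.v *)
From HB Require Import structures.
From mathcomp Require Import all_boot all_order all_algebra.
From mathcomp Require Import complex.
From mathcomp Require Import all_classical all_reals all_analysis.
Set Implicit Arguments.
Unset Strict Implicit.
Unset Printing Implicit Defensive.
Import Order.TTheory GRing.Theory Num.Theory.
Import numFieldNormedType.Exports.
Local Open Scope classical_set_scope.
Local Open Scope ring_scope.

Definition Cx (R : realType) : normedModType R[i] := (R[i])^o.

Definition cabs (R : realType) (z : R[i]) : R := complex.Re `|z|.
Definition vnorm (R : realType) (E : normedModType R[i]) (x : E) : R :=
  complex.Re `|x|.

(* A complex inner product inducing the norm of E.  Together with
   completeness of E (E : completeNormedModType R[i]) this makes E a
   complex Hilbert space (of arbitrary dimension). *)
Record inner_product (R : realType) (E : normedModType R[i]) := InnerProduct {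
  ip :> E -> E -> R[i];
  ip_linearl : forall (a : R[i]) (x y z : E), ip (a *: x + y) z = a * ip x z + ip y z;
  ip_conjsym : forall x y : E, ip y x = conjc (ip x y);
  ip_norm : forall x : E, ip x x = `|x| ^+ 2
}.

Section Bloch.
Variables (R : realType) (E : normedModType R[i]).

Definition ball1 : set E := [set x | vnorm x < 1].

(* f : B_E -> C is analytic (holomorphic): complex Frechet differentiable
   at every point of B_E. Values of f outside B_E are irrelevant. *)
Definition analytic_on_ball (W : normedModType R[i]) (f : E -> W) : Prop :=
  forall x, ball1 x -> differentiable f x.

Definition opnorm (L : E -> Cx R) : \bar R :=
  ereal_sup [set (cabs (L h))%:E | h in [set h | vnorm h <= 1]].

Definition bloch_seminorm (f : E -> Cx R) : \bar R :=
  ereal_sup [set ((1 - vnorm x ^+ 2)%:E * opnorm ('d f x))%E | x in ball1].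

Definition bloch_space (f : E -> Cx R) : Prop :=
  analytic_on_ball f /\ (bloch_seminorm f < +oo)%E.

Variable ipE : inner_product E.

Definition proj_a (a v : E) : E :=
  if a == 0 then 0 else (ipE v a / ipE a a) *: a.
Definition s_a (a : E) : R[i] := Complex (Num.sqrt (1 - vnorm a ^+ 2)) 0.

Definition mobius (a : E) (y : E) : E :=
  let w := (1 - ipE y a)^-1 *: (a - y) in
  s_a a *: (w - proj_a a w) + proj_a a w.

(* ||f||_inv = sup_{x in B_E} ||grad (f o phi_x)(0)||; the norm of the
   gradient vector equals the operator norm of the derivative (f o phi_x)'(0)
   (Riesz; coordinatewise conjugation is an isometry). *)
Definition inv_seminorm (f : E -> Cx R) : \bar R :=
  ereal_sup [set opnorm ('d (f \o mobius x) 0) | x in ball1].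

Definition bloch_norm (f : E -> Cx R) : \bar R :=
  ((cabs (f 0))%:E + inv_seminorm f)%E.

End Bloch.

(* Main.v *)
Require Import Defs.
From HB Require Import structures.
From mathcomp Require Import all_boot all_order all_algebra.
From mathcomp Require Import complex.
From mathcomp Require Import all_classical all_reals all_analysis.
From mathcomp Require Import ring lra.
Set Implicit Arguments.
Unset Strict Implicit.
Unset Printing Implicit Defensive.
Import Order.TTheory GRing.Theory Num.Theory.
Import numFieldNormedType.Exports.
Local Open Scope classical_set_scope.
Local Open Scope ring_scope.

(* If [psi] maps a disc of radius [rho] into the ball and [psi 0 = b], the scalar
   Cauchy estimate applied to [<mobius b (psi l), w>] shows that
   [psi'(0) = (mobius b)'(0) w] with [|w| <= 12 / rho].  By the chain rule a bound
   on the derivatives of all [f o mobius b] at 0 thus bounds [f o phi] in the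
   invariant seminorm, in the Bloch seminorm, and in value at 0.  That such a
   bound holds for every [f] in the Bloch space is Timoney's observation: the
   Bloch condition self-improves in directions tangent to the sphere, from
   [M / (1 - |a|^2)] to [C M / sqrt (1 - |a|^2)].  This is obtained by moving [a]
   towards the origin so that [1 - |a|^2] grows at least fourfold and iterating:
   the Cauchy estimate on the difference of [f] along two parallel tangent discs
   gives errors whose sum is geometric.

   The Cauchy estimate for functions that are merely complex differentiable is
   proved by Goursat's bisection, with dyadic midpoint sums in place of contour
   integrals: they are exactly additive under subdivision of a square and vanish
   on affine functions, so no integration theory is needed. *)

(** * The real-valued modulus on the complex numbers *)

Section ComplexModulus.
Variable R : realType.
Implicit Types (x : R) (z w : R[i]).

Lemma normrE_vnorm (E : normedModType R[i]) (x : E) : `|x| = (vnorm x)%:C%C.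
Proof. by rewrite /vnorm RRe_real // normr_real. Qed.

Lemma cabsE z : `|z| = (cabs z)%:C%C.
Proof. by rewrite /cabs RRe_real // normr_real. Qed.

Lemma cabs_ge0 z : 0 <= cabs z.
Proof. by rewrite -ler0c -cabsE normr_ge0. Qed.

Lemma cabs0 : cabs (0 : R[i]) = 0.
Proof. by rewrite /cabs normr0. Qed.

Lemma cabsM z w : cabs (z * w) = cabs z * cabs w.
Proof. by apply: complexI; rewrite rmorphM /= -!cabsE normrM. Qed.

Lemma cabsN z : cabs (- z) = cabs z.
Proof. by rewrite /cabs normrN. Qed.

Lemma ler_cabsD z w : cabs (z + w) <= cabs z + cabs w.
Proof. by rewrite -lecR rmorphD /= -!cabsE ler_normD. Qed.

Lemma ler_cabsB z w : cabs (z - w) <= cabs z + cabs w.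
Proof. by rewrite -(cabsN w) ler_cabsD. Qed.

Lemma cabsR x : cabs x%:C%C = `|x|.
Proof. by rewrite /cabs normc_def /= expr0n addr0 sqrtr_sqr. Qed.

Lemma cabs1 : cabs (1 : R[i]) = 1.
Proof. by rewrite /cabs normr1. Qed.

Lemma cabs_i : cabs ('i%C : R[i]) = 1.
Proof. by rewrite /cabs normc_def /= expr0n expr1n add0r sqrtr1. Qed.

Lemma cabsV z : cabs z^-1 = (cabs z)^-1.
Proof. by apply: complexI; rewrite fmorphV /= -!cabsE normfV. Qed.

Lemma cabs_eq0 z : (cabs z == 0) = (z == 0).
Proof. by rewrite -(inj_eq (@complexI R)) -cabsE normr_eq0. Qed.

Lemma cabs_gt0 z : (0 < cabs z) = (z != 0).
Proof. by rewrite lt_def cabs_ge0 andbT cabs_eq0. Qed.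

Lemma cabs_sqr z : cabs z ^+ 2 = complex.Re z ^+ 2 + complex.Im z ^+ 2.
Proof. by apply: complexI; rewrite rmorphXn /= -cabsE -add_Re2_Im2. Qed.

Lemma cabs_leReIm z : cabs z <= `|complex.Re z| + `|complex.Im z|.
Proof.
rewrite -(@ler_pXn2r _ 2) ?nnegrE ?cabs_ge0 ?addr_ge0 //.
rewrite cabs_sqr sqrrD !real_normK ?num_real //.
rewrite -subr_ge0.
have : 0 <= `|complex.Re z| * `|complex.Im z| by rewrite mulr_ge0.
rewrite -(real_normK (num_real (complex.Re z))) -(real_normK (num_real (complex.Im z))).
by move=> h; lra.
Qed.

Lemma Re_le_cabs z : `|complex.Re z| <= cabs z.
Proof. by rewrite -lecR -cabsE normc_ge_Re. Qed.

Lemma Im_le_cabs z : `|complex.Im z| <= cabs z.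
Proof.
rewrite -(@ler_pXn2r _ 2) ?nnegrE ?cabs_ge0 //.
by rewrite cabs_sqr real_normK ?num_real // lerDr sqr_ge0.
Qed.

Lemma ReD z w : complex.Re (z + w) = complex.Re z + complex.Re w.
Proof. by case: z w => [a b] [c d]. Qed.
Lemma ImD z w : complex.Im (z + w) = complex.Im z + complex.Im w.
Proof. by case: z w => [a b] [c d]. Qed.
Lemma ReN z : complex.Re (- z) = - complex.Re z.
Proof. by case: z. Qed.
Lemma ImN z : complex.Im (- z) = - complex.Im z.
Proof. by case: z. Qed.
Lemma ReM z w : complex.Re (z * w) =
  complex.Re z * complex.Re w - complex.Im z * complex.Im w.
Proof. by case: z w => [a b] [c d]. Qed.
Lemma ImM z w : complex.Im (z * w) =
  complex.Re z * complex.Im w + complex.Im z * complex.Re w.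
Proof. by case: z w => [a b] [c d]. Qed.

Lemma complex_ext z w : complex.Re z = complex.Re w ->
  complex.Im z = complex.Im w -> z = w.
Proof. by case: z w => [a b] [c d] /= -> ->. Qed.

End ComplexModulus.

(** * Bisection of squares *)

Section Squares.
Variable R : realType.
Local Notation C := R[i].
Local Notation I := ('i%C : R[i]).
Implicit Types (a z : C) (L l : R).

Definition in_square a L z : Prop :=
  complex.Re a <= complex.Re z <= complex.Re a + L /\
  complex.Im a <= complex.Im z <= complex.Im a + L.

(** The supremum of the left endpoints works: every right endpoint is an upper bound of all left
    endpoints. *)
Lemma nested_intervals (u l : nat -> R) :
  (forall n, 0 <= l n) -> (forall n, u n <= u n.+1) ->
  (forall n, u n.+1 + l n.+1 <= u n + l n) ->
  exists x, forall n, u n <= x <= u n + l n.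
Proof.
move=> l0 u_nd ul_ni.
have u_mono m n : u m <= u (m + n)%N.
  elim: n => [|n IH]; first by rewrite addn0.
  by rewrite addnS (le_trans IH).
have ul_mono m n : u (m + n)%N + l (m + n)%N <= u m + l m.
  elim: n => [|n IH]; first by rewrite addn0.
  by rewrite addnS (le_trans _ IH).
have uP m n : u m <= u n + l n.
  case: (leqP m n) => mn.
    by rewrite -(subnKC mn) (le_trans (u_mono m (n - m)%N)) // lerDl.
  by rewrite (le_trans _ (ul_mono n (m - n)%N)) // subnKC 1?ltnW // lerDl.
have ub n : ubound (range u) (u n + l n) by move=> _ [m _ <-]; exact: uP.
exists (sup (range u)) => n; apply/andP; split.
  by apply: ub_le_sup; [exists (u 0%N + l 0%N); exact: ub | exists n].
by apply: ge_sup; [exists (u 0%N), 0%N | exact: ub].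
Qed.

(** If [P] failed on the large square, it would fail on one of its quarters, and so on. These
    squares shrink to a point, where the local hypothesis contradicts the failure. *)
Lemma square_cousin (P : C -> R -> Prop) a0 L0 :
  (forall a L, 0 < L -> P a (L / 2) -> P (a + (L / 2)%:C%C) (L / 2) ->
     P (a + I * (L / 2)%:C%C) (L / 2) ->
     P (a + (L / 2)%:C%C + I * (L / 2)%:C%C) (L / 2) -> P a L) ->
  0 < L0 ->
  (forall z, in_square a0 L0 z -> exists2 d, 0 < d &
     forall a L, 0 < L < d -> in_square a L z -> P a L) ->
  P a0 L0.
Proof.
move=> Psub L0_gt0 Ploc; apply: contrapT => nP0.
pose bad (s : C * R) := 0 < s.2 /\ ~ P s.1 s.2.
pose nxt (s t : C * R) := [/\ bad t, t.2 = s.2 / 2,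
  complex.Re s.1 <= complex.Re t.1 <= complex.Re s.1 + s.2 / 2 &
  complex.Im s.1 <= complex.Im t.1 <= complex.Im s.1 + s.2 / 2].
(* [F] selects a bad quarter of each bad square; its value on other squares is arbitrary. *)
have /choice[F FP] : forall s, exists t, bad s -> nxt s t.
  move=> [a L]; case: (pselect (bad (a, L))) => [[/= L_gt0 nP]|]; last by exists (a, L).
  have L2 : 0 < L / 2 by rewrite divr_gt0.
  have Lp := ltW L2.
  apply: contrapT => /forallNP H; apply: nP; apply: Psub => //; apply: contrapT => nP.
  - by apply: (H (a, L / 2)) => _; split=> //=; rewrite lexx lerDl.
  - apply: (H (a + (L / 2)%:C%C, L / 2)) => _; split=> //=;
    by rewrite ?ReD ?ImD /= ?addr0 ?lexx ?lerDl ?Lp.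
  - apply: (H (a + I * (L / 2)%:C%C, L / 2)) => _; split=> //=;
    by rewrite ?ReD ?ImD ?ReM ?ImM /= !(mul0r, mul1r, mulr0, addr0, add0r, subr0) ?lexx ?lerDl ?Lp.
  - apply: (H (a + (L / 2)%:C%C + I * (L / 2)%:C%C, L / 2)) => _; split=> //=;
    by rewrite ?ReD ?ImD ?ReM ?ImM /= !(mul0r, mul1r, mulr0, addr0, add0r, subr0) ?lexx ?lerDl ?Lp.
pose s n := iter n F (a0, L0).
have bads n : bad (s n).
  by elim: n => [|n IH]; [split | have [] := FP _ IH].
have sS n : nxt (s n) (s n.+1) by exact: FP.
have s2 n : (s n).2 = L0 / 2 ^+ n.
  elim: n => [|n IH]; first by rewrite expr0 divr1.
  by have [_ -> _ _] := sS n; rewrite IH exprSr invfM mulrA.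
have s2_ge0 n : 0 <= (s n).2 by have [/ltW] := bads n.
have [x xP] : exists x, forall n, complex.Re (s n).1 <= x <= complex.Re (s n).1 + (s n).2.
  apply: nested_intervals => // n; have [_ E /andP[A B] _] := sS n;
    by have := s2_ge0 n; rewrite ?E; lra.
have [y yP] : exists x, forall n, complex.Im (s n).1 <= x <= complex.Im (s n).1 + (s n).2.
  apply: nested_intervals => // n; have [_ E _ /andP[A B]] := sS n;
    by have := s2_ge0 n; rewrite ?E; lra.
have [d d0 dP] := Ploc (Complex x y) (conj (xP 0%N) (yP 0%N)).
have [n Ln] : exists n, (s n).2 < d.
  exists (Num.bound (L0 / d)).
  rewrite s2 ltr_pdivrMr ?exprn_gt0 // mulrC -ltr_pdivrMr //.
  apply: (lt_trans (archi_boundP (ltW (divr_gt0 L0_gt0 d0)))).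
  by rewrite -natrX ltr_nat ltn_expl.
have [sn0 nPn] := bads n; apply: nPn; apply: dP; first by rewrite sn0.
by split; [exact: xP | exact: yP].
Qed.

End Squares.

(** * Goursat's lemma for dyadic midpoint sums *)

Section Goursat.
Variable R : realType.
Local Notation C := R[i].
Local Notation I := ('i%C : R[i]).
Implicit Types (k g : C -> C) (a z w : C) (L l : R) (n : nat).

(* [w * mean k n a w] is the midpoint sum of [k] over the [2 ^ n] equal parts of
   the segment from [a] to [a + w]; [contour k n a L] is the resulting
   approximation of the contour integral of [k] around the square with lower
   left corner [a] and side [L]. *)
Fixpoint mean k n a w : C :=
  if n is m.+1 then (mean k m a (w / 2) + mean k m (a + w / 2) (w / 2)) / 2
  else k (a + w / 2).

Definition contour k n a L : C := L%:C%C *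
  (mean k n a L%:C%C + I * mean k n (a + L%:C%C) (I * L%:C%C)
   - mean k n (a + I * L%:C%C) L%:C%C - I * mean k n a (I * L%:C%C)).

Lemma halfC L : (L / 2)%:C%C = L%:C%C / 2 :> C.
Proof. by rewrite rmorphM fmorphV rmorph_nat. Qed.

(** Each outer side is split into halves by the recursion of [mean], and each inner edge belongs to
    two quarters that traverse it in opposite directions. *)
Lemma contourS k n a L :
  let h := (L / 2)%:C%C in
  contour k n.+1 a L = contour k n a (L / 2) + contour k n (a + h) (L / 2)
    + contour k n (a + I * h) (L / 2) + contour k n (a + h + I * h) (L / 2).
Proof.
move=> h; rewrite /contour /=.
have -> : L%:C%C / 2 = h by rewrite /h halfC.
have -> : I * L%:C%C / 2 = I * h by rewrite /h halfC mulrA.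
rewrite -/h; have -> : L%:C%C = h + h by rewrite /h halfC -splitr.
have -> : a + (h + h) = a + h + h by ring.
have -> : a + I * (h + h) = a + I * h + I * h by ring.
have -> : a + I * h + h = a + h + I * h by ring.
have -> : a + h + I * h + h = a + h + h + I * h by ring.
have -> : a + I * h + I * h + h = a + h + I * h + I * h by ring.
by field.
Qed.

Lemma mean_lin k1 k2 c1 c2 n a w :
  mean (fun z => c1 * k1 z + c2 * k2 z) n a w = c1 * mean k1 n a w + c2 * mean k2 n a w.
Proof.
elim: n a w => [//|n IH] a w /=; rewrite !IH.
by field.
Qed.

Lemma mean_affine c d n a w : mean (fun z => c + d * z) n a w = c + d * (a + w / 2).
Proof.
elim: n a w => [//|n IH] a w /=; rewrite !IH.
by field.
Qed.

(** [mean] is an iterated midpoint of values of [k] on the segment, so it inherits every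
    midpoint-convex condition. This serves both for upper bounds of the modulus and for lower bounds
    of real-linear forms. *)
Lemma mean_ind k (Q : C -> Prop) n a w :
  (forall u v, Q u -> Q v -> Q ((u + v) / 2)) ->
  (forall t : R, 0 <= t <= 1 -> Q (k (a + t%:C%C * w))) ->
  Q (mean k n a w).
Proof.
move=> Qmid; elim: n a w => [|n IH] a w Qk /=.
  have := Qk 2^-1; rewrite fmorphV rmorph_nat mulrC; apply.
  by rewrite invr_ge0 ler0n invf_le1 ?ltr0n// ler1n.
apply: Qmid; apply: IH => t /andP[t0 t1].
  have -> : t%:C%C * (w / 2) = (t / 2)%:C%C * w by rewrite halfC; ring.
  by apply: Qk; apply/andP; split; lra.
have -> : a + w / 2 + t%:C%C * (w / 2) = a + ((t + 1) / 2)%:C%C * w.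
  by rewrite halfC rmorphD rmorph1; ring.
by apply: Qk; apply/andP; split; lra.
Qed.

Lemma mean_bound k n a w c :
  (forall t : R, 0 <= t <= 1 -> cabs (k (a + t%:C%C * w)) <= c) ->
  cabs (mean k n a w) <= c.
Proof.
apply: (@mean_ind k (fun z => cabs z <= c)) => u v uc vc.
have -> : (u + v) / 2 = (2^-1)%:C%C * (u + v) by rewrite fmorphV rmorph_nat mulrC.
rewrite cabsM cabsR ger0_norm ?invr_ge0//.
by have := ler_cabsD u v; lra.
Qed.

Definition cdiff_at k z d := forall e : R, 0 < e -> exists2 del : R, 0 < del &
  forall w, cabs (w - z) < del -> cabs (k w - k z - d * (w - z)) <= e * cabs (w - z).

Lemma in_square_dist a L z w : in_square a L z -> in_square a L w ->
  cabs (w - z) <= 2 * L.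
Proof.
move=> [/andP[? ?] /andP[? ?]] [/andP[? ?] /andP[? ?]].
rewrite (le_trans (cabs_leReIm _)) // ReD ImD ReN ImN mulr2n mulrDl mul1r.
by apply: lerD; rewrite ler_norml; apply/andP; split; lra.
Qed.

(** The bound is proportional to the area, so that the bounds for four quarters add up exactly to
    the bound for the square. The threshold [N] may depend on the square. *)
Definition contour_small k e a L :=
  exists N : nat, forall n, (N <= n)%N -> cabs (contour k n a L) <= e * L ^+ 2.

Lemma contour_bound k n a L c : 0 <= L ->
  (forall z, in_square a L z -> cabs (k z) <= c) -> cabs (contour k n a L) <= 4 * c * L.
Proof.
move=> L0 kc; rewrite /contour cabsM cabsR ger0_norm // mulrC ler_wpM2r //.
have H (b w : C) : (forall t : R, 0 <= t <= 1 -> in_square a L (b + t%:C%C * w)) ->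
    cabs (mean k n b w) <= c.
  by move=> bw; apply: mean_bound => t t01; apply/kc/bw.
have Lt (t : R) : 0 <= t <= 1 -> (0 <= t * L <= L)%R.
  by move=> /andP[t0 t1]; rewrite mulr_ge0 //= ler_piMl.
have H1 := H a L%:C%C; have H2 := H (a + L%:C%C) (I * L%:C%C).
have H3 := H (a + I * L%:C%C) L%:C%C; have H4 := H a (I * L%:C%C).
have -> : 4 * c = c + c + c + c by ring.
apply: (le_trans (ler_cabsB _ _)); apply: lerD; last first.
  rewrite cabsM cabs_i mul1r; apply: H4 => t /Lt /andP[? ?].
  rewrite /in_square !(ReD, ImD, ReM, ImM) /=.
  by split; apply/andP; split; lra.
apply: (le_trans (ler_cabsB _ _)); apply: lerD; last first.
  apply: H3 => t /Lt /andP[? ?].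
  rewrite /in_square !(ReD, ImD, ReM, ImM) /=.
  by split; apply/andP; split; lra.
apply: (le_trans (ler_cabsD _ _)); apply: lerD.
  apply: H1 => t /Lt /andP[? ?].
  rewrite /in_square !(ReD, ImD, ReM, ImM) /=.
  by split; apply/andP; split; lra.
rewrite cabsM cabs_i mul1r; apply: H2 => t /Lt /andP[? ?].
rewrite /in_square !(ReD, ImD, ReM, ImM) /=.
by split; apply/andP; split; lra.
Qed.

Lemma contour_lin k1 k2 c1 c2 n a L :
  contour (fun z => c1 * k1 z + c2 * k2 z) n a L
  = c1 * contour k1 n a L + c2 * contour k2 n a L.
Proof. by rewrite /contour !mean_lin; ring. Qed.

Lemma contour_affine c d n a L : contour (fun z => c + d * z) n a L = 0.
Proof. by rewrite /contour !mean_affine; field. Qed.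

(** Near a point, [k] is affine up to [e / 8] times the distance. The affine part has zero contour;
    on a small square of side [l] the distance is at most [2 * l], so the four sides contribute at
    most [e * l ^ 2]. Bisection passes from small squares to the given one. *)
Lemma goursat k a L : 0 < L ->
  (forall z, in_square a L z -> exists d, cdiff_at k z d) ->
  forall e : R, 0 < e -> contour_small k e a L.
Proof.
move=> L0 kd e e0; apply: (@square_cousin R (contour_small k e)) => //.
  move=> {kd L0} b l l0 [N1 P1] [N2 P2] [N3 P3] [N4 P4].
  (* The successor pays for the level of subdivision that [contourS] consumes. *)
  exists (N1 + N2 + N3 + N4).+1 => -[//|n]; rewrite ltnS contourS => nN.
  have n1 : (N1 <= n)%N by rewrite (leq_trans _ nN) // -!addnA leq_addr.
  have n2 : (N2 <= n)%N by rewrite (leq_trans _ nN) // -!addnA addnCA leq_addr.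
  have n3 : (N3 <= n)%N by rewrite (leq_trans _ nN) // -addnA addnCA leq_addr.
  have n4 : (N4 <= n)%N by rewrite (leq_trans _ nN) // leq_addl.
  have -> : e * l ^+ 2 = e * (l / 2) ^+ 2 + e * (l / 2) ^+ 2
    + e * (l / 2) ^+ 2 + e * (l / 2) ^+ 2 by field.
  apply: (le_trans (ler_cabsD _ _)); apply: lerD; last exact: P4.
  apply: (le_trans (ler_cabsD _ _)); apply: lerD; last exact: P3.
  by apply: (le_trans (ler_cabsD _ _)); apply: lerD; [exact: P1 | exact: P2].
move=> z /kd[d dP].
have [del del0 H] := dP (e / 8) (divr_gt0 e0 (ltr0n _ 8)).
exists (del / 2); first exact: divr_gt0.
move=> b l /andP[l0 ld] zb; exists 0%N => n _.
pose r w := k w - k z - d * (w - z).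
have -> : k = fun w => 1 * ((k z - d * z) + d * w) + 1 * r w.
  by apply/funext => w; rewrite /r; ring.
rewrite contour_lin contour_affine mulr0 add0r mul1r.
have -> : e * l ^+ 2 = 4 * (e / 8 * (2 * l)) * l by field.
apply: contour_bound => [|w wb]; first exact: ltW.
have wz := in_square_dist zb wb.
apply: (le_trans (H w _)); first by apply: (le_lt_trans wz); lra.
by rewrite ler_wpM2l //; lra.
Qed.

End Goursat.

(** * From Frechet derivatives to estimates with real constants *)

Section Differentiability.
Variable R : realType.

Lemma pos_complexP (e : R[i]) : 0 < e -> 0 < complex.Re e /\ e = (complex.Re e)%:C%C.
Proof.
move=> e0; have E : e = (complex.Re e)%:C%C by rewrite RRe_real // gtr0_real.
by split=> //; rewrite -ltcR -E.
Qed.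

Lemma differentiable_eps (V W : normedModType R[i]) (f : V -> W) x :
  differentiable f x -> forall e : R, 0 < e -> exists2 del : R, 0 < del &
  forall y, vnorm (y - x) < del ->
    vnorm (f y - f x - 'd f x (y - x)) <= e * vnorm (y - x).
Proof.
move=> /diff_locally/eqaddoP H e e0.
have {}H := H e%:C%C _.
have : 0 < e%:C%C by rewrite ltcR.
move=> /H; rewrite -nbhs_nearE => /nbhs_normP[d /= /pos_complexP[d0 dE]] dP.
exists (complex.Re d) => // y yd.
have /dP : (ball_ Num.norm (0 : V) d) (y - x).
  by rewrite /ball_ /= sub0r normrN dE normrE_vnorm ltcR.
by rewrite !fctE /= subrK !normrE_vnorm -rmorphM lecR opprD addrA.
Qed.

Lemma differentiable_cdiff_at (f : Cx R -> Cx R) (z : Cx R) :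
  differentiable f z -> cdiff_at f z ('d f z (1 : Cx R)).
Proof.
move=> fz e e0; have [del del0 H] := differentiable_eps fz e0.
exists del => // w /H.
suff -> : 'd f z (w - z) = 'd f z (1 : Cx R) * (w - z) by [].
rewrite -[in LHS](mulr1 (w - z)) -[(w - z) * 1]/((w - z) *: (1 : Cx R)).
by rewrite linearZ /= mulrC.
Qed.

End Differentiability.

(** * Square loops around the origin *)

Section SquareLoops.
Variable R : realType.
Local Notation C := R[i].
Local Notation I := ('i%C : R[i]).
Implicit Types (k : C -> C) (a b z w d : C) (r : R) (n : nat).

(* The contour of [[-r, r] ^ 2], as the sum of those of its four quadrants; the
   edges through 0 cancel formally, so [k 0] is irrelevant. *)
Definition loop k n r : C :=
  contour k n 0 r + contour k n (- r%:C%C) r + contour k n (- (I * r%:C%C)) r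
  + contour k n (- r%:C%C - I * r%:C%C) r.

Lemma loop_edges k n r : let x := r%:C%C in let y := I * r%:C%C in
  loop k n r = x * ((mean k n (- x - y) x + mean k n (- y) x)
    + (I * mean k n (x - y) y + I * mean k n x y)
    - (mean k n (- x + y) x + mean k n y x)
    - (I * mean k n (- x - y) y + I * mean k n (- x) y)).
Proof.
move=> x y; rewrite /loop /contour -/x -/y.
have -> : - x - y + x = - y by ring.
have -> : - x - y + y = - x by ring.
have -> : - y + x = x - y by ring.
by rewrite !add0r !addNr; ring.
Qed.

(** Lower left corners of the twelve squares of side [h] left in the 4 by 4 grid on [[-2h, 2h] ^ 2]
    once the four squares touching 0 are removed. *)
Definition outer_corners (h : R) : seq C :=
  let x := h%:C%C in let y := I * h%:C%C in
  [:: x; y; x + y; - x - x; - x - x + y; - x + y; - y - y; - y - y + x; - y + x;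
      - x - x - y - y; - x - y - y; - x - x - y].

(** Each quadrant has exactly one quarter touching 0; these four quarters form the loop of half the
    size. *)
Lemma loopS k n r : loop k n.+1 r =
  loop k n (r / 2) + \sum_(b <- outer_corners (r / 2)) contour k n b (r / 2).
Proof.
rewrite /loop !contourS /outer_corners !big_cons big_nil.
set h := (r / 2)%:C%C; have -> : r%:C%C = h + h by rewrite /h halfC -splitr.
set c := contour k n ^~ (r / 2).
rewrite -!/(c _) !add0r.
have -> : - (h + h) + h = - h by ring.
have -> : - (I * (h + h)) + h + I * h = - (I * h) + h by ring.
have -> : - (I * (h + h)) + I * h = - (I * h) by ring.
have -> : - (h + h) - I * (h + h) + h + I * h = - h - I * h by ring.
have -> : - (h + h) - I * (h + h) + h = - h - I * h - I * h by ring.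
have -> : - (h + h) - I * (h + h) + I * h = - h - h - I * h by ring.
have -> : - (h + h) - I * (h + h) = - h - h - I * h - I * h by ring.
have -> : - (h + h) = - h - h by ring.
have -> : - (I * (h + h)) = - (I * h) - (I * h) by ring.
by ring.
Qed.

Lemma outer_cornersP (h : R) b z : 0 < h -> b \in outer_corners h ->
  in_square b h z -> z != 0 /\ cabs z <= 4 * h.
Proof.
move=> h0; rewrite /outer_corners !inE.
(* A square of side [h] misses 0 as soon as one coordinate of its corner is at least [h] or at most
   [- 2 h]. *)
have H : forall p q : R, h <= p \/ p <= - h - h \/ h <= q \/ q <= - h - h ->
    - h - h <= p <= h -> - h - h <= q <= h ->
    b = Complex p q -> in_square b h z -> z != 0 /\ cabs z <= 4 * h.
  move=> p q Hpq /andP[p1 p2] /andP[q1 q2] -> [/= /andP[z1 z2] /andP[z3 z4]].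
  split.
    apply/eqP => z0; move: z1 z2 z3 z4; rewrite z0 /= => *.
    by case: Hpq => [|[|[]]] => ?; lra.
  apply: (le_trans (cabs_leReIm z)).
  suff : `|complex.Re z| <= 2 * h /\ `|complex.Im z| <= 2 * h by lra.
  by split; rewrite ler_norml; apply/andP; split; lra.
do 11?[case/orP]; move=> /eqP Eb.
all: apply: (H (complex.Re b) (complex.Im b)) => //; rewrite ?Eb;
  rewrite ?(ReD, ImD, ReM, ImM, ReN, ImN) /=; try (by apply/andP; split; lra);
  try by apply: complex_ext.
all: try (by left; lra); try (by right; left; lra).
all: try (by right; right; left; lra); try (by right; right; right; lra).
Qed.

(** Each of the eight half-sides contributes at most [c * r]. On the boundary some coordinate is [r]
    or [- r], hence the modulus is at least [r], and [k] need not be controlled near 0. *)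
Lemma loop_bound k n r c : 0 < r ->
  (forall z, `|complex.Re z| <= r -> `|complex.Im z| <= r -> r <= cabs z ->
     cabs (k z) <= c) ->
  cabs (loop k n r) <= 8 * c * r.
Proof.
move=> r0 kc; rewrite loop_edges cabsM cabsR gtr0_norm // mulrC ler_pM2r //.
have H (b w : C) : (forall t : R, 0 <= t * r <= r -> let u := complex.Re (b + t%:C%C * w) in
    let v := complex.Im (b + t%:C%C * w) in
    [/\ - r <= u <= r, - r <= v <= r & [\/ u = r, u = - r, v = r | v = - r]]) ->
    cabs (mean k n b w) <= c.
  move=> bw; apply: mean_bound => t /andP[t0 t1].
  have /bw : 0 <= t * r <= r by rewrite mulr_ge0 ?ler_piMl // ltW.
  move: (b + _) => z /=; rewrite -!ler_norml => -[H1 H2 H3]; apply: kc => //.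
  have := Re_le_cabs z; have := Im_le_cabs z.
  by case: H3 => ->; rewrite ?normrN ?[`|r|]gtr0_norm.
have HI (b w : C) : cabs (mean k n b w) <= c -> cabs (I * mean k n b w) <= c.
  by rewrite cabsM cabs_i mul1r.
have H2 (u v : C) : cabs u <= c -> cabs v <= c -> cabs (u + v) <= 2 * c.
  by move=> uc vc; apply: (le_trans (ler_cabsD _ _)); lra.
have -> : 8 * c = 2 * c + 2 * c + 2 * c + 2 * c by ring.
apply: (le_trans (ler_cabsB _ _)); apply: lerD.
  apply: (le_trans (ler_cabsB _ _)); apply: lerD.
    apply: (le_trans (ler_cabsD _ _)); apply: lerD.
      apply: H2; apply: H => t /andP[t0 t1]; cbv zeta; rewrite !(ReD, ImD, ReM, ImM, ReN, ImN) /=.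
        by split; [apply/andP; split; lra|apply/andP; split; lra|apply: Or44; lra].
      by split; [apply/andP; split; lra|apply/andP; split; lra|apply: Or44; lra].
    apply: H2; apply: HI; apply: H => t /andP[t0 t1]; cbv zeta; rewrite !(ReD, ImD, ReM, ImM, ReN, ImN) /=.
      by split; [apply/andP; split; lra|apply/andP; split; lra|apply: Or41; lra].
    by split; [apply/andP; split; lra|apply/andP; split; lra|apply: Or41; lra].
  apply: H2; apply: H => t /andP[t0 t1]; cbv zeta; rewrite !(ReD, ImD, ReM, ImM, ReN, ImN) /=.
    by split; [apply/andP; split; lra|apply/andP; split; lra|apply: Or43; lra].
  by split; [apply/andP; split; lra|apply/andP; split; lra|apply: Or43; lra].
apply: H2; apply: HI; apply: H => t /andP[t0 t1]; cbv zeta; rewrite !(ReD, ImD, ReM, ImM, ReN, ImN) /=.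
  by split; [apply/andP; split; lra|apply/andP; split; lra|apply: Or42; lra].
by split; [apply/andP; split; lra|apply/andP; split; lra|apply: Or42; lra].
Qed.

End SquareLoops.

(** * The loop of the function [1 / z] *)

Section LoopOfInverse.
Variable R : realType.
Local Notation C := R[i].
Local Notation I := ('i%C : R[i]).
Implicit Types (z : C) (r : R) (n : nat).

Lemma Re_inv z : complex.Re z^-1 = complex.Re z / (complex.Re z ^+ 2 + complex.Im z ^+ 2).
Proof. by case: z. Qed.

Lemma Im_inv z : complex.Im z^-1 = - complex.Im z / (complex.Re z ^+ 2 + complex.Im z ^+ 2).
Proof. by case: z => a b /=; rewrite mulNr. Qed.

(* [(a, b) \in {(1, 0), (-1, 0), (0, 1), (0, -1)}] selects the real-linear form
   [z |-> a Re z + b Im z] that the four sides of the square need. *)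
Lemma mean_ge (k : C -> C) n p w (a b c : R) :
  (forall t : R, 0 <= t <= 1 ->
     let v := k (p + t%:C%C * w) in c <= a * complex.Re v + b * complex.Im v) ->
  c <= a * complex.Re (mean k n p w) + b * complex.Im (mean k n p w).
Proof.
apply: (@mean_ind R k (fun v => c <= a * complex.Re v + b * complex.Im v)) => u v.
have -> : (u + v) / 2 = (2^-1)%:C%C * (u + v) by rewrite fmorphV rmorph_nat mulrC.
rewrite !(ReM, ImM, ReD, ImD) /=.
set x := complex.Re u; set y := complex.Re v; set x' := complex.Im u; set y' := complex.Im v.
by move=> *; lra.
Qed.

Ltac square_side := move=> t /andP[? ?]; cbv zeta; rewrite !(ReD, ImD, ReM, ImM, ReN, ImN) /=;
  split; [lra|apply/andP; split; lra].

(* The exact value of the limit is [2 pi]; any positive lower bound suffices. *)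
Lemma loop_inv_ge n r : 0 < r -> 4 <= complex.Im (loop (fun z => z^-1) n r).
Proof.
move=> r0; rewrite loop_edges.
have K (u : R) : - r <= u <= r -> (2 * r)^-1 <= r / (r ^+ 2 + u ^+ 2).
  move=> /andP[ur1 ur2]; have u2 : u ^+ 2 <= r ^+ 2 by nra.
  have p0 : 0 < r ^+ 2 + u ^+ 2 by have := exprn_gt0 2 r0; have := sqr_ge0 u; lra.
  rewrite ler_pdivlMr // mulrC ler_pdivrMr ?mulr_gt0 //.
  by rewrite mulrCA -expr2; lra.
have T (t : R) : 0 <= t <= 1 -> 0 <= t * r <= r.
  by move=> /andP[t0 t1]; rewrite mulr_ge0 ?ler_piMl // ltW.
(* The unit vector [(a, b)] rotates the side onto the line [Re = r]. With [u] the other rotated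
   coordinate, the form applied to [1 / z] equals [r / (r ^ 2 + u ^ 2)]. *)
have H (a b : R) (p w : C) : a ^+ 2 + b ^+ 2 = 1 ->
    (forall t, 0 <= t * r <= r -> let x := complex.Re (p + t%:C%C * w) in
       let y := complex.Im (p + t%:C%C * w) in
       a * x - b * y = r /\ - r <= a * y + b * x <= r) ->
    (2 * r)^-1 <= a * complex.Re (mean (fun z => z^-1) n p w)
                  + b * complex.Im (mean (fun z => z^-1) n p w).
  move=> ab pw; apply: mean_ge => t /T /pw; move: (p + _) => z /= [E1 E2].
  rewrite Re_inv Im_inv.
  have -> : complex.Re z ^+ 2 + complex.Im z ^+ 2
      = r ^+ 2 + (a * complex.Im z + b * complex.Re z) ^+ 2.
    by rewrite -E1 -[LHS]mul1r -ab; ring.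
  rewrite (_ : _ + _ = r / (r ^+ 2 + (a * complex.Im z + b * complex.Re z) ^+ 2)) ?K //.
  by move: (_ ^+ 2 + _ ^+ 2) => D; rewrite -E1; ring.
have Hb : 0 ^+ 2 + 1 ^+ 2 = 1 :> R by ring.
have Hr : 1 ^+ 2 + 0 ^+ 2 = 1 :> R by ring.
have Ht : 0 ^+ 2 + (-1) ^+ 2 = 1 :> R by ring.
have Hl : (-1) ^+ 2 + 0 ^+ 2 = 1 :> R by ring.
have b1 := H _ _ (- r%:C%C - I * r%:C%C) r%:C%C Hb ltac:(square_side).
have b2 := H _ _ (- (I * r%:C%C)) r%:C%C Hb ltac:(square_side).
have r1 := H _ _ (r%:C%C - I * r%:C%C) (I * r%:C%C) Hr ltac:(square_side).
have r2 := H _ _ r%:C%C (I * r%:C%C) Hr ltac:(square_side).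
have t1 := H _ _ (- r%:C%C + I * r%:C%C) r%:C%C Ht ltac:(square_side).
have t2 := H _ _ (I * r%:C%C) r%:C%C Ht ltac:(square_side).
have l1 := H _ _ (- r%:C%C - I * r%:C%C) (I * r%:C%C) Hl ltac:(square_side).
have l2 := H _ _ (- r%:C%C) (I * r%:C%C) Hl ltac:(square_side).
rewrite !(ReD, ImD, ReM, ImM, ReN, ImN) /=.
(* Eight half-sides of length [r], each with mean at least [1 / (2 r)]. *)
have -> : 4 = r * (8 * (2 * r)^-1) by field; rewrite gt_eqF.
rewrite !(mul0r, mul1r, add0r, addr0, sub0r) ler_pM2l //.
move: b1 b2 r1 r2 t1 t2 l1 l2; rewrite !(mul0r, mul1r, mulN1r, add0r, addr0) => *.
by lra.
Qed.

End LoopOfInverse.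

(** * Cauchy's estimate for the first derivative *)

Section CauchyEstimate.
Variable R : realType.
Local Notation C := R[i].
Implicit Types (k : C -> C) (a b z w d : C) (r : R) (n : nat).

Lemma sum_contours_small k (s : seq C) h :
  (forall b, b \in s -> forall e : R, 0 < e -> contour_small k e b h) ->
  forall e : R, 0 < e -> exists N, forall n, (N <= n)%N ->
    cabs (\sum_(b <- s) contour k n b h) <= e * h ^+ 2.
Proof.
elim: s => [|b s IH] H e e0.
  by exists 0%N => n _; rewrite big_nil cabs0 mulr_ge0 ?sqr_ge0 // ltW.
have e2 : 0 < e / 2 by rewrite divr_gt0.
have [|N1 P1] := IH _ _ e2; first by move=> c cs; apply: H; rewrite inE cs orbT.
have [N2 P2] := H b (mem_head _ _) _ e2.
exists (N1 + N2)%N => n nN; rewrite big_cons (le_trans (ler_cabsD _ _)) //.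
have := P1 n (leq_trans (leq_addr _ _) nN); have := P2 n (leq_trans (leq_addl _ _) nN).
by move=> *; lra.
Qed.

(* Goursat on the twelve outer squares shrinks the loop around 0 to half its size. *)
Lemma loop_shrink k (rho c : R) :
  (forall z, z != 0 -> cabs z < rho -> exists d, cdiff_at k z d) ->
  forall r, 0 < r -> 2 * r < rho ->
  (forall n, cabs (loop k n r) <= c) ->
  forall m (e : R), 0 < e -> exists N, forall n, (N <= n)%N ->
    cabs (loop k n (r / 2 ^+ m)) <= c + e.
Proof.
move=> kd r r0 rrho kc; elim=> [|m IH] e e0.
  by exists 0%N => n _; rewrite expr0 divr1 (le_trans (kc n)) // lerDl ltW.
pose h := r / 2 ^+ m.+1.
have h0 : 0 < h by rewrite divr_gt0 // exprn_gt0.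
have hr : h <= r / 2.
  rewrite /h exprS invfM mulrA ler_piMr //; first by rewrite divr_ge0 // ltW.
  by rewrite invf_le1 ?exprn_gt0 // exprn_ege1 // ler1n.
have e2 : 0 < e / 2 by rewrite divr_gt0.
(* Dividing by [h ^ 2] cancels the area factor in the Goursat bound. *)
have e3 : 0 < e / 2 / h ^+ 2 by rewrite divr_gt0 // exprn_gt0.
have [N1 P1] := IH _ e2.
have [|N2 P2] := @sum_contours_small k (outer_corners h) h _ _ e3.
  move=> b bh; apply: goursat => // z zb.
  have [z0 zr] := outer_cornersP h0 bh zb.
  by apply: kd => //; apply: (le_lt_trans zr); lra.
exists (N1 + N2)%N => n nN.
(* [loopS] relates level [n.+1] on the large loop to level [n] on the small one. *)
have := P1 n.+1 (leq_trans (leq_trans (leq_addr _ _) nN) (leqnSn _)).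
have -> : r / 2 ^+ m = 2 * h by rewrite /h exprS; field; rewrite expf_neq0 // pnatr_eq0.
rewrite loopS (_ : 2 * h / 2 = h); last by field.
have := P2 n (leq_trans (leq_addl _ _) nN).
rewrite divfK ?expf_neq0 ?gt_eqF // -/h.
set u := loop _ _ _; set v := \sum_(b <- _) _ => v1 uv1.
rewrite -[u](addrK v) (le_trans (ler_cabsB _ _)) //.
by lra.
Qed.

(* [k z = (g z - g 0) / z ^ 2] has residue [g'(0)] at 0: compare its integral
   over the square of half-side [rho / 3] and over squares shrinking to 0. *)
Lemma cauchy_estimate (g : Cx R -> Cx R) (rho M : R) : 0 < rho ->
  (forall z : Cx R, cabs z < rho -> differentiable g z) ->
  (forall z, cabs z < rho -> cabs (g z) <= M) ->
  cabs ('d g (0 : Cx R) (1 : Cx R)) <= 12 * M / rho.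
Proof.
move=> rho0 gd gM.
pose d := 'd g (0 : Cx R) (1 : Cx R); rewrite -/d.
pose k z := (g z - g 0) * (z * z)^-1.
pose r := rho / 3.
have r0 : 0 < r by rewrite divr_gt0.
have rrho : 2 * r < rho by rewrite /r; lra.
have M0 : 0 <= M by rewrite (le_trans _ (gM 0 _)) ?cabs_ge0 ?cabs0.
have kd z : z != 0 -> cabs z < rho -> exists d, cdiff_at k z d.
  move=> z0 /gd gz; eexists.
  apply: (@differentiable_cdiff_at R k z).
  apply: (@differentiableM _ _ (fun z : Cx R => g z - g 0 : Cx R) (fun z : Cx R => (z * z)^-1 : Cx R)).
    by apply: differentiableB.
  apply: (@differentiableV _ _ (fun z : Cx R => z * z : Cx R)); last by rewrite mulf_neq0.
  by apply: differentiableM.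
have kM z : r <= cabs z -> cabs z < rho -> cabs (k z) <= 2 * M / r ^+ 2.
  move=> rz zrho; rewrite /k cabsM cabsV cabsM -expr2.
  rewrite ler_pM ?invr_ge0 ?sqr_ge0 ?cabs_ge0 //.
    rewrite (le_trans (ler_cabsB _ _)) // mulrDl mul1r lerD ?gM //.
    by rewrite cabs0.
  rewrite lef_pV2 ?posrE ?exprn_gt0 ?(lt_le_trans r0) //.
  by rewrite ler_pXn2r ?nnegrE ?cabs_ge0 // ltW.
pose c := 16 * M / r.
have kc n : cabs (loop k n r) <= c.
  rewrite (_ : c = 8 * (2 * M / r ^+ 2) * r); last by rewrite /c; field; rewrite gt_eqF.
  apply: loop_bound => // z zr zi rz; apply: kM => //.
  by rewrite (le_lt_trans (cabs_leReIm z)) // (le_lt_trans _ rrho) //; lra.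
have shrink := @loop_shrink k rho c kd r r0 rrho kc.
(* The factor 4 is the lower bound for the loop of [1 / z]; dividing [c = 16 M / r] by it gives
   [12 M / rho]. *)
suff H e : 0 < e -> 4 * cabs d <= c + e.
  have : 4 * cabs d <= c by apply/ler_addgt0Pr.
  by rewrite /c /r => H4; rewrite (_ : 12 * M / rho = 16 * M / (rho / 3) / 4); [lra | field; rewrite gt_eqF].
move=> e0; have e16 : 0 < e / 16 by rewrite divr_gt0.
have [] := differentiable_cdiff_at (gd 0 _) e16; first by rewrite cabs0.
move=> del del0; rewrite -/d => gdel.
have [m mP] : exists m, r / 2 ^+ m < del / 2.
  exists (Num.bound (r / (del / 2))).
  rewrite ltr_pdivrMr ?exprn_gt0 // mulrC -ltr_pdivrMr ?divr_gt0 //.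
  apply: (lt_trans (archi_boundP (ltW (divr_gt0 r0 (divr_gt0 del0 (ltr0n _ 2)))))).
  by rewrite -natrX ltr_nat ltn_expl.
have [N NP] := shrink m (e / 2) (divr_gt0 e0 (ltr0n _ 2)).
have := NP N (leqnn N).
set s := r / _ in mP *.
have s0 : 0 < s by rewrite divr_gt0 // exprn_gt0.
(* On the small square [err z] is at most [e / 16] divided by the modulus of [z]. Its loop is then
   at most [e / 2], independently of the half-side [s]; the other [e / 2] was spent on shrinking. *)
pose err z := k z - d * z^-1.
have -> : k = fun z => d * z^-1 + 1 * err z.
  by apply/funext => z; rewrite /err; ring.
have -> n : loop (fun z => d * z^-1 + 1 * err z) n s =
    d * loop (fun z => z^-1) n s + loop err n s.
  by rewrite /loop !contour_lin; ring.
have errb : cabs (loop err N s) <= 8 * (e / 16 / s) * s.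
  apply: loop_bound => // z zr zi sz.
  have z0 : 0 < cabs z by rewrite (lt_le_trans s0).
  have zn0 : z != 0 by rewrite -cabs_gt0.
  have -> : err z = (g z - g 0 - d * z) / (z * z).
    by rewrite /err /k; field.
  have zdel : cabs (z - 0) < del.
    rewrite subr0 (le_lt_trans (cabs_leReIm z)) // (le_lt_trans (lerD zr zi)) //.
    by lra.
  have := gdel z zdel; rewrite subr0 => gz.
  rewrite cabsM cabsV cabsM.
  apply: (@le_trans _ _ (e / 16 / cabs z)).
    rewrite invfM mulrA ler_pM2r ?invr_gt0 // ler_pdivrMr //.
  by rewrite ler_pM2l // lef_pV2 ?posrE.
have := loop_inv_ge N s0; have := Im_le_cabs (loop (fun z => z^-1) N s).
set W := loop (fun z => _) _ _; move: errb; set E := loop err _ _.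
rewrite (_ : 8 * (e / 16 / s) * s = e / 2); last by field; rewrite gt_eqF.
move=> E1 W1 W2 dW.
have W3 : 4 <= cabs W by rewrite (le_trans W2) // (le_trans _ W1) // ler_norm.
have : cabs (d * W) <= c + e.
  rewrite -[d * W](addrK E) (le_trans (ler_cabsB _ _)) //.
  by lra.
rewrite cabsM; apply: le_trans; rewrite mulrC.
by rewrite ler_wpM2l ?cabs_ge0.
Qed.

End CauchyEstimate.

(** * Mean value inequality and Cauchy's estimate along complex lines *)

Section MeanValue.
Variable R : realType.

Lemma vnorm_ge0 (E : normedModType R[i]) (x : E) : 0 <= vnorm x.
Proof. by rewrite -ler0c -normrE_vnorm normr_ge0. Qed.

Lemma vnormZ (E : normedModType R[i]) (c : R[i]) (x : E) :
  vnorm (c *: x) = cabs c * vnorm x.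
Proof. by apply: complexI; rewrite rmorphM /= -!normrE_vnorm -cabsE normrZ. Qed.

Lemma ler_vnormD (E : normedModType R[i]) (x y : E) : vnorm (x + y) <= vnorm x + vnorm y.
Proof. by rewrite -lecR rmorphD /= -!normrE_vnorm ler_normD. Qed.

Lemma vnormN (E : normedModType R[i]) (x : E) : vnorm (- x) = vnorm x.
Proof. by rewrite /vnorm normrN. Qed.

Lemma vnorm0 (E : normedModType R[i]) : vnorm (0 : E) = 0.
Proof. by rewrite /vnorm normr0. Qed.

Lemma vnorm_eq0 (E : normedModType R[i]) (x : E) : (vnorm x == 0) = (x == 0).
Proof. by rewrite -(inj_eq (@complexI R)) -normrE_vnorm normr_eq0. Qed.

(** [square_cousin], applied to a predicate that ignores imaginary parts, is bisection of [[0, 1]].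
    The slack [eta] absorbs the differentiation error on short intervals. *)
Lemma mean_value_real (c D : R -> R[i]) (K : R) :
  (forall t, 0 <= t <= 1 -> cabs (D t) <= K /\
     forall e, 0 < e -> exists2 del : R, 0 < del & forall s, `|s - t| < del ->
       cabs (c s - c t - (s - t)%:C%C * D t) <= e * `|s - t|) ->
  cabs (c 1 - c 0) <= K.
Proof.
move=> cD; apply/ler_addgt0Pr => eta eta0.
pose P (a : R[i]) (L : R) := cabs (c (complex.Re a + L) - c (complex.Re a)) <= (K + eta) * L.
suff : P 0 1 by rewrite /P /= add0r mulr1.
apply: (@square_cousin _ P) => //.
  move=> a L L0; rewrite /P => P1 P2 _ _.
  move: P2; rewrite ReD /= -addrA -splitr => P2.
  rewrite (_ : c _ - c _ = (c (complex.Re a + L) - c (complex.Re a + L / 2))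
    + (c (complex.Re a + L / 2) - c (complex.Re a))); last by ring.
  by rewrite (le_trans (ler_cabsD _ _)) //; lra.
move=> z [/= z01 _]; move: z01; rewrite add0r; set t := complex.Re z.
move=> /cD[DK /(_ _ eta0)[del del0 H]].
exists del => // a l /andP[l0 ldel] [+ _]; rewrite /P -/t.
set b := complex.Re a => /andP[bt tl].
(* As [t] lies between [b] and [b + l], the errors at the two ends add up to [eta * l]. *)
have H1 : cabs (c (b + l) - c t - (b + l - t)%:C%C * D t) <= eta * (b + l - t).
  have E : `|b + l - t| = b + l - t by rewrite ger0_norm //; lra.
  by have := H (b + l); rewrite E; apply; lra.
have H2 : cabs (c b - c t - (b - t)%:C%C * D t) <= eta * (t - b).
  have E : `|b - t| = t - b by rewrite ler0_norm; lra.
  by have := H b; rewrite E; apply; lra.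
have -> : c (b + l) - c b = (c (b + l) - c t - (b + l - t)%:C%C * D t)
   - (c b - c t - (b - t)%:C%C * D t) + l%:C%C * D t.
  by rewrite !(rmorphB, rmorphD) /=; ring.
rewrite (le_trans (ler_cabsD _ _)) // cabsM cabsR gtr0_norm //.
have := ler_cabsB (c (b + l) - c t - (b + l - t)%:C%C * D t) (c b - c t - (b - t)%:C%C * D t).
have : l * cabs (D t) <= l * K by rewrite ler_pM2l.
by lra.
Qed.

Lemma mean_value (E : normedModType R[i]) (f : E -> Cx R) (x v : E) (K : R) :
  (forall t : R, 0 <= t <= 1 -> differentiable f (x + t%:C%C *: v)) ->
  (forall t : R, 0 <= t <= 1 -> cabs ('d f (x + t%:C%C *: v) v) <= K) ->
  cabs (f (x + v) - f x) <= K.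
Proof.
move=> fd fK.
have := @mean_value_real (fun t => f (x + t%:C%C *: v)) (fun t => 'd f (x + t%:C%C *: v) v) K.
rewrite /= scale1r scale0r addr0; apply => t t01; split; first exact: fK.
(* One divides by [vnorm v + 1] because [v] may be 0. *)
move=> e e0; have v0 : 0 < vnorm v + 1 by rewrite ltr_wpDl ?vnorm_ge0.
have [del del0 H] := differentiable_eps (fd t t01) (divr_gt0 e0 v0).
exists (del / (vnorm v + 1)); first exact: divr_gt0.
move=> s sdel; have E1 : x + s%:C%C *: v - (x + t%:C%C *: v) = (s - t)%:C%C *: v.
  by rewrite opprD addrACA subrr add0r -scalerBl rmorphB.
have N : vnorm ((s - t)%:C%C *: v) = `|s - t| * vnorm v by rewrite vnormZ cabsR.
have N1 : `|s - t| * vnorm v <= `|s - t| * (vnorm v + 1) by rewrite ler_wpM2l // lerDl.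
have := H (x + s%:C%C *: v); rewrite E1 N linearZ /= => /(_ _)/le_trans; apply.
  by rewrite (le_lt_trans N1) // -ltr_pdivlMr.
by rewrite -mulrA [_^-1 * _]mulrC mulrA ler_pdivrMr // -mulrA ler_pM2l.
Qed.

Lemma is_diff_line (E : normedModType R[i]) (x v : E) (l : Cx R) :
  is_diff l (fun m : Cx R => x + m *: v) (fun m : Cx R => m *: v).
Proof.
have -> : (fun m : Cx R => x + m *: v) = cst x + (fun m : Cx R => m *: v) by [].
apply: is_diff_eq; rewrite add0r //.
Qed.

Lemma cauchy_estimate_dir (E : normedModType R[i]) (f : E -> Cx R) (x v : E) (rho M : R) :
  0 < rho ->
  (forall l : R[i], cabs l < rho -> differentiable f (x + l *: v)) ->
  (forall l : R[i], cabs l < rho -> cabs (f (x + l *: v)) <= M) ->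
  cabs ('d f x v) <= 12 * M / rho.
Proof.
move=> rho0 fd fM.
pose g (l : Cx R) : Cx R := f (x + l *: v).
have gd (l : Cx R) : cabs l < rho -> differentiable g l.
  move=> lr; have := is_diff_line x v l => dl.
  by apply: (@differentiable_comp _ _ _ _ (fun m : Cx R => x + m *: v) f) => //; exact: fd.
have := cauchy_estimate rho0 gd fM.
rewrite (@diff_comp _ _ _ _ (fun m : Cx R => x + m *: v) f) /=.
- have dl := is_diff_line x v (0 : Cx R).
  by rewrite diff_val scale1r scale0r addr0.
- exact: (@ex_diff _ _ _ _ _ _ _ (is_diff_line x v (0 : Cx R))).
- by apply: fd; rewrite cabs0.
Qed.

End MeanValue.

(** * Derivatives of bounded linear maps and of scalar multiples *)

Section DifferentiationRules.
Variable R : realType.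

Lemma is_diff_bounded_linear (V W : normedModType R[i]) (f : V -> W) (K : R) (x : V) :
  linear f -> (forall y, vnorm (f y) <= K * vnorm y) -> is_diff x f f.
Proof.
move=> flin fK.
pose fM := GRing.isLinear.Build _ _ _ _ _ flin.
pose fL : {linear V -> W} := HB.pack f fM.
have fc : continuous fL.
  apply/bounded_linear_continuous/linear_boundedP.
  exists K%:C%C; split; first by rewrite complex_real.
  move=> M KM y; rewrite (le_trans _ (ler_wpM2r _ (ltW KM))) //.
  by rewrite !normrE_vnorm -rmorphM lecR; exact: fK.
by split; [exact: (@linear_differentiable _ _ _ fL) | exact: (@diff_lin _ _ _ fL)].
Qed.

Lemma is_diff_scale (V W : normedModType R[i]) (k dk : V -> Cx R) (F dF : V -> W) (x : V) :
  is_diff x k dk -> is_diff x F dF ->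
  is_diff x (fun y => k y *: F y) (fun h => k x *: dF h + dk h *: F x).
Proof.
move=> kx Fx.
have sb : bilinear_for (GRing.Scale.Law.clone _ _ *:%R _) (GRing.Scale.Law.clone _ _ *:%R _)
    ((fun (c : Cx R) (w : W) => c *: w) : Cx R -> W -> W).
  split=> [w|c] a u v /=; first by rewrite scalerDl scalerA.
  by rewrite scalerDr !scalerA mulrC.
pose sM := bilinear_isBilinear.Build _ _ _ _ _ _ _ sb.
pose sB : {bilinear Cx R -> W -> W} := HB.pack ((fun (c : Cx R) (w : W) => c *: w) : Cx R -> W -> W) sM.
have sc : continuous (fun p : Cx R * W => sB p.1 p.2) by exact: scale_continuous.
have sd : is_diff (k x, F x) (fun p : Cx R * W => sB p.1 p.2)
    (fun q => k x *: q.2 + q.1 *: F x).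
  split; first exact: differentiable_bilin.
  by rewrite diff_bilin.
by have := is_diff_comp (is_diff_pair kx Fx) sd.
Qed.

End DifferentiationRules.

(** * Inner product geometry and the operator [s_a Q_a + P_a] *)

Section InnerProduct.
Variables (R : realType) (E : normedModType R[i]) (ipE : inner_product E).
Implicit Types (x y z a : E) (c : R[i]).

Lemma ipDl x y z : ipE (x + y) z = ipE x z + ipE y z.
Proof. by rewrite -{1}[x]scale1r ip_linearl mul1r. Qed.

Lemma ip0l z : ipE 0 z = 0.
Proof. by apply: (addIr (ipE 0 z)); rewrite -ipDl !add0r. Qed.

Lemma ipZl c x z : ipE (c *: x) z = c * ipE x z.
Proof. by rewrite -[c *: x]addr0 ip_linearl ip0l addr0. Qed.

Lemma ipNl x z : ipE (- x) z = - ipE x z.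
Proof. by rewrite -scaleN1r ipZl mulN1r. Qed.

Lemma ipBl x y z : ipE (x - y) z = ipE x z - ipE y z.
Proof. by rewrite ipDl ipNl. Qed.

Lemma ipDr x y z : ipE z (x + y) = ipE z x + ipE z y.
Proof. by rewrite (ip_conjsym ipE (x + y)) ipDl rmorphD /= -!(ip_conjsym ipE). Qed.

Lemma ipZr c x z : ipE z (c *: x) = conjc c * ipE z x.
Proof. by rewrite (ip_conjsym ipE (c *: x)) ipZl rmorphM /= -(ip_conjsym ipE). Qed.

Lemma ipNr x z : ipE z (- x) = - ipE z x.
Proof. by rewrite (ip_conjsym ipE (- x)) ipNl rmorphN /= -(ip_conjsym ipE). Qed.

Lemma ip0r z : ipE z 0 = 0.
Proof. by rewrite (ip_conjsym ipE 0) ip0l conjc0. Qed.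

Lemma ip_vnorm x : ipE x x = (vnorm x ^+ 2)%:C%C.
Proof. by rewrite ip_norm normrE_vnorm -rmorphXn. Qed.

Lemma vnormD_sqr x y :
  vnorm (x + y) ^+ 2 = vnorm x ^+ 2 + vnorm y ^+ 2 + 2 * complex.Re (ipE x y).
Proof.
have -> : vnorm (x + y) ^+ 2 = complex.Re (ipE (x + y) (x + y)) by rewrite ip_vnorm.
rewrite ipDl !ipDr !ip_vnorm (ip_conjsym ipE x y) !ReD /=.
by case: (ipE x y) => u v /=; ring.
Qed.

Lemma pythagoras x y : ipE x y = 0 ->
  vnorm (x + y) ^+ 2 = vnorm x ^+ 2 + vnorm y ^+ 2.
Proof. by move=> xy; rewrite vnormD_sqr xy mulr0 addr0. Qed.

Lemma vnormB_sqr x y :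
  vnorm (x - y) ^+ 2 = vnorm x ^+ 2 + vnorm y ^+ 2 - 2 * complex.Re (ipE x y).
Proof. by rewrite vnormD_sqr vnormN ipNr ReN mulrN. Qed.

Lemma cauchy_schwarz x y : cabs (ipE x y) <= vnorm x * vnorm y.
Proof.
have [->|y0] := eqVneq y 0; first by rewrite ip0r cabs0 mulr_ge0 ?vnorm_ge0.
have ny : 0 < vnorm y by rewrite lt_def vnorm_ge0 vnorm_eq0 y0.
set p := ipE x y; set Y := vnorm y in ny *.
(* The vector is [x] minus its orthogonal projection on [y]. *)
have := sqr_ge0 (vnorm (x - ((Y ^+ 2)^-1%:C%C * p) *: y)).
rewrite vnormB_sqr vnormZ ipZr -/p -/Y cabsM cabsR ger0_norm ?invr_ge0 ?sqr_ge0 //.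
have -> : complex.Re (conjc (((Y ^+ 2)^-1)%:C%C * p) * p) = (Y ^+ 2)^-1 * cabs p ^+ 2.
  by rewrite cabs_sqr; case: (p) => u v /=; ring.
have -> : vnorm x ^+ 2 + ((Y ^+ 2)^-1 * cabs p * Y) ^+ 2 - 2 * ((Y ^+ 2)^-1 * cabs p ^+ 2)
    = vnorm x ^+ 2 - cabs p ^+ 2 / Y ^+ 2 by field; rewrite gt_eqF.
rewrite subr_ge0 ler_pdivrMr ?exprn_gt0 // -exprMn.
by rewrite ler_pXn2r ?nnegrE ?mulr_ge0 ?cabs_ge0 ?vnorm_ge0 // ltW.
Qed.

Lemma proj_aE a v : (vnorm a ^+ 2)%:C%C *: proj_a ipE a v = ipE v a *: a.
Proof.
rewrite /proj_a -ip_vnorm; case: eqP => [->|/eqP a0]; first by rewrite !scaler0.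
rewrite scalerA mulrC divfK // ip_vnorm.
by rewrite -(rmorph0 (@real_complex R)) (inj_eq (@complexI R)) sqrf_eq0 vnorm_eq0.
Qed.

Lemma proj_aZ a c v : proj_a ipE a (c *: v) = c *: proj_a ipE a v.
Proof.
by rewrite /proj_a; case: ifP => _; rewrite ?scaler0 // scalerA ipZl mulrA.
Qed.

Lemma proj_aD a u v : proj_a ipE a (u + v) = proj_a ipE a u + proj_a ipE a v.
Proof.
by rewrite /proj_a; case: ifP => _; rewrite ?addr0 // -scalerDl ipDl mulrDl.
Qed.

Lemma proj_a_line a v : exists c, proj_a ipE a v = c *: a.
Proof. by rewrite /proj_a; case: eqP => _; [exists 0; rewrite scale0r | eexists]. Qed.

Lemma ip_proj_a a v : ipE (proj_a ipE a v) a = ipE v a.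
Proof.
rewrite /proj_a; case: eqP => [->|/eqP a0]; first by rewrite !ip0r.
rewrite ipZl divfK // ip_vnorm.
by rewrite -(rmorph0 (@real_complex R)) (inj_eq (@complexI R)) sqrf_eq0 vnorm_eq0.
Qed.

Lemma ip_perp_proj_a a u v : ipE (u - proj_a ipE a u) (proj_a ipE a v) = 0.
Proof.
by have [c ->] := proj_a_line a v; rewrite ipZr ipBl ip_proj_a subrr mulr0.
Qed.

Lemma proj_a_self a : proj_a ipE a a = a.
Proof.
rewrite /proj_a; case: eqP => [-> //|/eqP a0]; rewrite divff ?scale1r // ip_vnorm.
by rewrite -(rmorph0 (@real_complex R)) (inj_eq (@complexI R)) sqrf_eq0 vnorm_eq0.
Qed.

Lemma vnorm_proj_a a v : vnorm v ^+ 2 =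
  vnorm (v - proj_a ipE a v) ^+ 2 + vnorm (proj_a ipE a v) ^+ 2.
Proof. by rewrite -pythagoras ?ip_perp_proj_a // subrK. Qed.

Lemma vnorm_proj_a_ip a v : vnorm a ^+ 2 * vnorm (proj_a ipE a v) ^+ 2 = cabs (ipE v a) ^+ 2.
Proof.
have [->|a0] := eqVneq a 0; first by rewrite ip0r cabs0 vnorm0 expr0n mul0r.
have A0 : vnorm a ^+ 2 != 0 by rewrite sqrf_eq0 vnorm_eq0.
have := congr1 (fun v => vnorm v ^+ 2) (proj_aE a v).
rewrite !vnormZ cabsR ger0_norm ?sqr_ge0 // !exprMn => H.
by apply: (mulfI A0); rewrite [RHS]mulrC -H; ring.
Qed.

(* The operator [s_a Q_a + P_a] of the definition of [mobius]. *)
Definition mobius_op a v : E :=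
  s_a a *: (v - proj_a ipE a v) + proj_a ipE a v.

Lemma mobius_op_linear a : linear (mobius_op a).
Proof.
move=> c u v; rewrite /mobius_op proj_aD proj_aZ.
have -> : c *: u + v - (c *: proj_a ipE a u + proj_a ipE a v)
    = c *: (u - proj_a ipE a u) + (v - proj_a ipE a v).
  by rewrite opprD addrACA scalerBr.
by rewrite !scalerDr addrACA !scalerA [c * s_a a]mulrC.
Qed.

Lemma mobius_opZ a c v : mobius_op a (c *: v) = c *: mobius_op a v.
Proof.
by rewrite /mobius_op proj_aZ -scalerBr [RHS]scalerDr !scalerA [c * s_a a]mulrC.
Qed.

Definition sigma a : R := Num.sqrt (1 - vnorm a ^+ 2).

Lemma s_aE a : s_a a = (sigma a)%:C%C.
Proof. by []. Qed.

Lemma ball1_sqr a : ball1 a -> vnorm a ^+ 2 < 1.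
Proof. by rewrite /ball1 /= => a1; rewrite exprn_ilt1 // vnorm_ge0. Qed.

Lemma sigma_gt0 a : ball1 a -> 0 < sigma a.
Proof. by move=> /ball1_sqr a1; rewrite sqrtr_gt0 subr_gt0. Qed.

Lemma sigma_sqr a : ball1 a -> sigma a ^+ 2 = 1 - vnorm a ^+ 2.
Proof. by move=> /ball1_sqr a1; rewrite sqr_sqrtr // subr_ge0 ltW. Qed.

(** By Pythagoras the left side is [sigma a ^ 2 |Q v| ^ 2 + |P v| ^ 2]. Splitting
    [1 = sigma a ^ 2 + |a| ^ 2] in the last term yields the formula, also for [a = 0]. *)
Lemma vnorm_mobius_op a v : ball1 a ->
  vnorm (mobius_op a v) ^+ 2 = sigma a ^+ 2 * vnorm v ^+ 2 + cabs (ipE v a) ^+ 2.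
Proof.
move=> a1; rewrite /mobius_op pythagoras ?ipZl ?ip_perp_proj_a ?mulr0 //.
rewrite vnormZ s_aE cabsR gtr0_norm ?sigma_gt0 // exprMn -vnorm_proj_a_ip.
by rewrite (vnorm_proj_a a v) sigma_sqr //; ring.
Qed.

Lemma vnorm_mobius_op_le a v : ball1 a -> vnorm (mobius_op a v) <= vnorm v.
Proof.
move=> a1; rewrite -(@ler_pXn2r _ 2) ?nnegrE ?vnorm_ge0 //.
rewrite vnorm_mobius_op // sigma_sqr //.
have : cabs (ipE v a) ^+ 2 <= (vnorm v * vnorm a) ^+ 2.
  by rewrite ler_pXn2r ?nnegrE ?mulr_ge0 ?cabs_ge0 ?vnorm_ge0 // cauchy_schwarz.
by rewrite exprMn => ?; lra.
Qed.

Lemma mobius_op_perp a v : ipE v a = 0 -> mobius_op a v = s_a a *: v.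
Proof.
move=> va; rewrite /mobius_op.
by have -> : proj_a ipE a v = 0; rewrite /proj_a ?va ?mul0r ?scale0r ?if_same ?subr0 ?addr0.
Qed.

Lemma mobius_op_decomp a v :
  exists u w, [/\ v = u + w, ipE u a = 0, exists c, w = c *: a,
    mobius_op a v = s_a a *: u + w & vnorm v ^+ 2 = vnorm u ^+ 2 + vnorm w ^+ 2].
Proof.
exists (v - proj_a ipE a v), (proj_a ipE a v); split=> //.
- by rewrite subrK.
- by rewrite ipBl ip_proj_a subrr.
- exact: proj_a_line.
- exact: vnorm_proj_a.
Qed.

(** The computation behind [diff_mobiusK]. Orthogonally to [a] the operator acts as [sigma a],
    applied twice; on the line of [a] it is the identity and the subtracted term is [|a| ^ 2] times
    the component. *)
Lemma mobius_opK a v : ball1 a ->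
  mobius_op a (mobius_op a v) - mobius_op a (ipE (mobius_op a v) a *: a)
  = (1 - vnorm a ^+ 2)%:C%C *: v.
Proof.
move=> a1; rewrite -sigma_sqr //.
have TD u w : mobius_op a (u + w) = mobius_op a u + mobius_op a w.
  by have := mobius_op_linear a 1 u w; rewrite !scale1r.
have [u [w [-> ua [c ->] -> _]]] := mobius_op_decomp a v.
have Ta : mobius_op a a = a by rewrite /mobius_op proj_a_self subrr scaler0 add0r.
rewrite TD !mobius_opZ (mobius_op_perp ua) Ta ipDl !ipZl ua mulr0 add0r ip_vnorm.
rewrite -addrA -scalerBl scalerA scalerDr scalerA.
have -> : s_a a * s_a a = (sigma a ^+ 2)%:C%C by rewrite s_aE -rmorphM expr2.
by congr (_ + _ *: _); rewrite sigma_sqr // rmorphB rmorph1; ring.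
Qed.

End InnerProduct.

(** * Moebius maps of the ball and a Schwarz-Pick estimate *)

Section Mobius.
Variables (R : realType) (E : normedModType R[i]) (ipE : inner_product E).
Implicit Types (x y v w a b : E) (c : R[i]).
Local Notation T := (mobius_op ipE).
Local Notation mob := (mobius ipE).

Lemma mobius_opN a v : T a (- v) = - T a v.
Proof. by rewrite -scaleN1r mobius_opZ scaleN1r. Qed.

Lemma mobius_op_self a : T a a = a.
Proof. by rewrite /mobius_op proj_a_self subrr scaler0 add0r. Qed.

Lemma mobiusE a y : mob a y = (1 - ipE y a)^-1 *: T a (a - y).
Proof. by rewrite -mobius_opZ. Qed.

Lemma mobius0 a : mob a 0 = a.
Proof. by rewrite mobiusE ip0l !subr0 invr1 scale1r mobius_op_self. Qed.

Lemma mobius_den_neq0 a y : ball1 a -> ball1 y -> 1 - ipE y a != 0.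
Proof.
rewrite /ball1 /= => a1 y1; apply/eqP => /subr0_eq H.
have := cauchy_schwarz ipE y a; rewrite -H cabs1.
have : vnorm y * vnorm a < 1 by rewrite mulr_ilt1 ?vnorm_ge0.
by move=> *; lra.
Qed.

(** Rests on the identity [|1 - <y, a>| ^ 2 - |T a (a - y)| ^ 2 = (1 - |a| ^ 2) (1 - |y| ^ 2)]. *)
Lemma mobius_ball a y : ball1 a -> ball1 y -> ball1 (mob a y).
Proof.
move=> a1 y1; have d0 := mobius_den_neq0 a1 y1.
have A1 := ball1_sqr a1; have Y1 := ball1_sqr y1.
rewrite /ball1 /= -(@ltr_pXn2r _ 2) ?nnegrE ?vnorm_ge0 ?ler01 // expr1n.
rewrite mobiusE vnormZ exprMn cabsV exprVn mulrC ltr_pdivrMr; last first.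
  by rewrite exprn_gt0 // cabs_gt0.
rewrite mul1r vnorm_mobius_op // sigma_sqr // (vnormB_sqr ipE) ipBl ip_vnorm !cabs_sqr.
rewrite !(ReD, ReN, ImD, ImN) /=.
have -> : complex.Re (ipE a y) = complex.Re (ipE y a).
  by rewrite (ip_conjsym ipE y a); case: (ipE y a).
set p := complex.Re _; set q := complex.Im _.
rewrite -subr_gt0.
have : 0 < (1 - vnorm a ^+ 2) * (1 - vnorm y ^+ 2) by rewrite mulr_gt0 // subr_gt0.
by congr (0 < _); ring.
Qed.

Lemma is_diff_mobius a y : ball1 a -> ball1 y ->
  is_diff y (mob a) (fun h => (1 - ipE y a)^-1 *: T a (- h)
     + ((1 - ipE y a) ^- 2 * ipE h a) *: T a (a - y)).
Proof.
move=> a1 y1; have d0 := mobius_den_neq0 a1 y1.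
have dip : is_diff y (fun x => ipE x a : Cx R) (fun h => ipE h a : Cx R).
  apply: (@is_diff_bounded_linear _ _ _ _ (vnorm a)).
    by move=> c u v; rewrite ip_linearl.
  by move=> x; rewrite mulrC; exact: cauchy_schwarz.
have dden : is_diff y (fun x => 1 - ipE x a : Cx R) (fun h => - ipE h a : Cx R).
  have -> : (fun x => 1 - ipE x a : Cx R) = cst (1 : Cx R) - (fun x => ipE x a : Cx R) by [].
  by apply: is_diff_eq; rewrite add0r.
have dk : is_diff y (fun x => (1 - ipE x a)^-1 : Cx R)
    (fun h => (1 - ipE y a) ^- 2 * ipE h a : Cx R).
  split.
    by apply: (@differentiableV _ _ (fun x => 1 - ipE x a : Cx R)).
  rewrite (@diffV _ _ (fun x => 1 - ipE x a : Cx R)) // diff_val.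
  by apply/funext => h; rewrite /= [_ *: _]mulrNN.
have dT : is_diff (a - y) (T a) (T a).
  apply: (@is_diff_bounded_linear _ _ _ _ 1); first exact: mobius_op_linear.
  by move=> x; rewrite mul1r; exact: vnorm_mobius_op_le.
have dB : is_diff y (fun x => a - x) (fun h => - h).
  have -> : (fun x => a - x) = cst a - id by [].
  by apply: is_diff_eq; rewrite add0r.
have -> : mob a = (fun x => (1 - ipE x a)^-1 *: (T a \o (fun x => a - x)) x).
  by apply/funext => x; rewrite mobiusE.
exact: is_diff_scale dk (is_diff_comp dB dT).
Qed.

Lemma diff_mobius0 a h : ball1 a -> 'd (mob a) 0 h = T a (ipE h a *: a - h).
Proof.
move=> a1; have y1 : ball1 (0 : E) by rewrite /ball1 /= vnorm0.
have D := is_diff_mobius a1 y1; rewrite diff_val ip0l !subr0 invr1 expr1n invr1.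
rewrite scale1r mul1r mobius_opN mobius_op_self.
have := mobius_op_linear ipE a (ipE h a) a (- h).
by rewrite mobius_opN mobius_op_self addrC => ->.
Qed.

Lemma diff_mobius_self a h : ball1 a ->
  'd (mob a) a h = - (1 - vnorm a ^+ 2)%:C%C^-1 *: T a h.
Proof.
move=> a1; have D := is_diff_mobius a1 a1; rewrite diff_val subrr.
have -> : T a 0 = 0 by rewrite -(scale0r (0 : E)) mobius_opZ !scale0r.
by rewrite scaler0 addr0 mobius_opN scalerN scaleNr ip_vnorm rmorphB rmorph1.
Qed.

(** The infinitesimal form of [mob a] being an involution that exchanges 0 and [a], computed
    directly from the two derivatives. *)
Lemma diff_mobiusK a v : ball1 a -> 'd (mob a) 0 ('d (mob a) a v) = v.
Proof.
move=> a1; have s0 : (1 - vnorm a ^+ 2)%:C%C != 0 :> R[i].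
  by rewrite -(rmorph0 (@real_complex R)) (inj_eq (@complexI R)) subr_eq0 gt_eqF ?ball1_sqr.
rewrite diff_mobius_self // linearZ /= diff_mobius0 // -(opprB (T a v)) mobius_opN.
have -> : T a (T a v - ipE (T a v) a *: a) =
    T a (T a v) - T a (ipE (T a v) a *: a).
  by have := mobius_op_linear ipE a 1 (T a v) (- (ipE (T a v) a *: a));
     rewrite !scale1r mobius_opN.
by rewrite mobius_opK // scaleNr scalerN opprK scalerA mulVf // scale1r.
Qed.

(** Pairing [mob b \o psi] with [w], its own derivative, gives a scalar function bounded by
    [vnorm w] with derivative [vnorm w ^ 2]; one factor cancels in Cauchy's estimate. *)
Lemma schwarz_pick (V : normedModType R[i]) (psi : V -> E) (x v : V) (rho : R) :
  0 < rho ->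
  (forall l : R[i], cabs l < rho -> differentiable psi (x + l *: v)) ->
  (forall l : R[i], cabs l < rho -> ball1 (psi (x + l *: v))) ->
  exists2 w, 'd psi x v = 'd (mob (psi x)) 0 w & vnorm w <= 12 / rho.
Proof.
move=> rho0 dpsi psi1; set b := psi x.
have r00 : cabs (0 : R[i]) < rho by rewrite cabs0.
have b1 : ball1 b by have := psi1 _ r00; rewrite scale0r addr0.
have dx : differentiable psi x by have := dpsi _ r00; rewrite scale0r addr0.
pose w := 'd (mob b) b ('d psi x v).
exists w; first by rewrite /w diff_mobiusK.
have dip (y : E) : is_diff y (fun z => ipE z w : Cx R) (fun h => ipE h w : Cx R).
  apply: (@is_diff_bounded_linear _ _ _ _ (vnorm w)).
    by move=> c u z; rewrite ip_linearl.
  by move=> z; rewrite mulrC; exact: cauchy_schwarz.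
have dmob y : ball1 y -> differentiable (mob b) y.
  by move=> y1; exact: (@ex_diff _ _ _ _ _ _ _ (is_diff_mobius b1 y1)).
have dG (y : V) : differentiable psi y -> ball1 (psi y) ->
    is_diff y ((fun z => ipE z w : Cx R) \o (mob b \o psi))
     ((fun h => ipE h w : Cx R) \o ('d (mob b) (psi y) \o 'd psi y)).
  move=> dy y1; have := dmob _ y1 => /differentiableP dm.
  have /differentiableP dp := dy.
  exact: is_diff_comp.
have := @cauchy_estimate_dir R V ((fun z => ipE z w : Cx R) \o (mob b \o psi)) x v rho (vnorm w) rho0.
have D := dG x dx b1; rewrite diff_val /= -/w ip_vnorm cabsR ger0_norm ?sqr_ge0 //.
have [->|w0] := eqVneq w 0; first by rewrite vnorm0 divr_ge0 // ltW.
have nw : 0 < vnorm w by rewrite lt_def vnorm_ge0 vnorm_eq0 w0.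
move=> H; rewrite -(ler_pM2r nw) -expr2 mulrAC; apply: H => l lr.
  by apply: (@ex_diff _ _ _ _ _ _ _ (dG _ (dpsi l lr) (psi1 l lr))).
rewrite (le_trans (cauchy_schwarz ipE _ _)) // ler_piMl ?vnorm_ge0 //.
by apply: ltW; apply: mobius_ball => //; exact: psi1.
Qed.

End Mobius.

(** * Timoney's tangential estimate *)

Lemma cabs_linearZ (R : realType) (E : normedModType R[i]) (L : {linear E -> Cx R})
    (c : R[i]) (x : E) : cabs (L (c *: x)) = cabs c * cabs (L x).
Proof. by rewrite linearZ -cabsM. Qed.

Section Timoney.
Variables (R : realType) (E : normedModType R[i]) (ipE : inner_product E).
Variables (f : E -> Cx R) (M : R).
Hypothesis f_an : analytic_on_ball f.
Hypothesis f_bloch : forall x h, ball1 x ->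
  (1 - vnorm x ^+ 2) * cabs ('d f x h) <= M * vnorm h.
Implicit Types (x y v w a b : E).

Lemma ball1_of_sqr x : vnorm x ^+ 2 < 1 -> ball1 x.
Proof.
by move=> x1; rewrite /ball1 /= -(@ltr_pXn2r _ 2) ?nnegrE ?vnorm_ge0 ?ler01 // expr1n.
Qed.

Lemma vnorm_tangent a v (s : R) (l : R[i]) : ipE v a = 0 ->
  vnorm (s%:C%C *: a + l *: v) ^+ 2 = s ^+ 2 * vnorm a ^+ 2 + cabs l ^+ 2 * vnorm v ^+ 2.
Proof.
move=> va; rewrite addrC (pythagoras (ipE := ipE)); last first.
  by rewrite ipZl ipZr va !mulr0.
by rewrite !vnormZ !exprMn cabsR real_normK ?num_real // addrC.
Qed.

(* Bound of the tangential derivative by the one at [(1 - 4 s ^ 2) a], where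
   [s] is at least twice as large: along the discs of radius [s / 2] in direction
   [v] around the two points, the values of [f] differ by [O(M)], by the mean
   value inequality. *)
Lemma tangential_step a v : ball1 a -> ipE v a = 0 -> 0 <= M ->
  let s := sigma a in
  4 * s ^+ 2 <= 1 ->
  cabs ('d f a v) * s <= cabs ('d f ((1 - 4 * s ^+ 2)%:C%C *: a) v) * s + 192 * (M * vnorm v).
Proof.
move=> a1 va M0 s s1.
have [->|v0] := eqVneq v 0.
  by rewrite !linear0 cabs0 vnorm0 !mul0r mulr0 mulr0 addr0.
have nv : 0 < vnorm v by rewrite lt_def vnorm_ge0 vnorm_eq0 v0.
have s0 : 0 < s by exact: sigma_gt0.
have sE : s ^+ 2 = 1 - vnorm a ^+ 2 by exact: sigma_sqr.
have s20 : 0 < s ^+ 2 by rewrite exprn_gt0.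
pose u := (4 * s ^+ 2)%:C%C *: a.
pose rho := s / (2 * vnorm v).
have rho0 : 0 < rho by rewrite divr_gt0 // mulr_gt0.
(* By orthogonality the squared norm is at most [|a| ^ 2 + (s / 2) ^ 2 = 1 - 3 s ^ 2 / 4], so the
   Bloch weight is at least [s ^ 2 / 2] on all segments joining the two discs. *)
have pt (l : R[i]) (t : R) : cabs l < rho -> 0 <= t <= 1 ->
    vnorm (a + l *: v - u + t%:C%C *: u) ^+ 2 <= 1 - s ^+ 2 / 2.
  move=> lr /andP[t0 t1].
  have -> : a + l *: v - u + t%:C%C *: u = (1 - 4 * s ^+ 2 * (1 - t))%:C%C *: a + l *: v.
    rewrite -!addrA [l *: v + _]addrC !addrA; congr (_ + _).
    rewrite /u scalerA -{1}[a]scale1r -scalerBl -scalerDl; congr (_ *: _).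
    by rewrite !(rmorphB, rmorphM) rmorph1 /=; ring.
  rewrite vnorm_tangent //.
  have lv : cabs l ^+ 2 * vnorm v ^+ 2 <= s ^+ 2 / 4.
    rewrite -exprMn (_ : s ^+ 2 / 4 = (s / 2) ^+ 2); last by field.
    rewrite ler_pXn2r ?nnegrE ?mulr_ge0 ?cabs_ge0 ?vnorm_ge0 ?divr_ge0 ?(ltW s0) //.
    rewrite (_ : s / 2 = rho * vnorm v); last by rewrite /rho; field; rewrite gt_eqF.
    by rewrite ler_pM2r // ltW.
  have : (1 - 4 * s ^+ 2 * (1 - t)) ^+ 2 * vnorm a ^+ 2 <= vnorm a ^+ 2.
    rewrite ler_piMl ?sqr_ge0 // expr_le1 //; nra.
  by lra.
have pt1 (l : R[i]) (t : R) : cabs l < rho -> 0 <= t <= 1 ->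
    ball1 (a + l *: v - u + t%:C%C *: u).
  by move=> lr t01; apply: ball1_of_sqr; rewrite (le_lt_trans (pt l t lr t01)) //; lra.
have ptl (l : R[i]) : cabs l < rho -> ball1 (a + l *: v - u).
  by move=> lr; have := pt1 l 0 lr; rewrite scale0r addr0; apply; rewrite lexx ler01.
have ptr (l : R[i]) : cabs l < rho -> ball1 (a + l *: v).
  by move=> lr; have := pt1 l 1 lr; rewrite scale1r subrK; apply; rewrite lexx ler01.
have dS y : is_diff y (fun y : E => y - u) id.
  have -> : (fun y : E => y - u) = id + cst (- u) by [].
  by apply: is_diff_eq; rewrite subr0.
pose g : E -> Cx R := f - (f \o (fun y => y - u)).
have dg y : ball1 y -> ball1 (y - u) -> is_diff y g (fun h => 'd f y h - 'd f (y - u) h : Cx R).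
  move=> y1 yu1; have /differentiableP D1 := f_an y1; have /differentiableP D2 := f_an yu1.
  have D3 := is_diff_comp (dS y) D2; exact: is_diffB.
have r00 : cabs (0 : R[i]) < rho by rewrite cabs0.
have a10 : ball1 (a - u) by have := ptl _ r00; rewrite scale0r addr0.
have au : a - u = (1 - 4 * s ^+ 2)%:C%C *: a.
  by rewrite /u rmorphB rmorph1 scalerBl scale1r.
have Dv : 'd g a v = 'd f a v - 'd f ((1 - 4 * s ^+ 2)%:C%C *: a) v.
  by rewrite -au; exact: (congr1 (fun k : E -> Cx R => k v) (@diff_val _ _ _ _ _ _ _ (dg a a1 a10))).
(* The length of [u] is at most [4 s ^ 2] and the weight at least [s ^ 2 / 2], whence [8 M]. With
   [1 / rho = 2 |v| / s] this becomes the constant 192. *)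
have H : cabs ('d g a v) <= 12 * (8 * M) / rho.
  apply: (cauchy_estimate_dir rho0) => l lr.
    exact: (@ex_diff _ _ _ _ _ _ _ (dg _ (ptr l lr) (ptl l lr))).
  have -> : g (a + l *: v) = f (a + l *: v) - f (a + l *: v - u) by [].
  rewrite -[X in f X - _](subrK u); apply: mean_value => t t01.
    by apply: f_an; exact: pt1.
  have := f_bloch u (pt1 l t lr t01); set p := _ - u + _; set d := cabs _ => fd.
  have nu : vnorm u <= 4 * s ^+ 2.
    have s4 : 0 <= 4 * s ^+ 2 by rewrite mulr_ge0 // sqr_ge0.
    rewrite /u vnormZ cabsR (ger0_norm s4) -[leRHS]mulr1 ler_wpM2l //.
    by move: a1; rewrite /ball1 /= => /ltW.
  have : M * vnorm u <= M * (4 * s ^+ 2) by rewrite ler_wpM2l.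
  have d0 : 0 <= d by exact: cabs_ge0.
  have ps := pt l t lr t01; rewrite -/p in ps.
  move=> Mu; rewrite -(@ler_pM2l _ (s ^+ 2 / 2)) ?divr_gt0 //.
  have : s ^+ 2 / 2 * d <= (1 - vnorm p ^+ 2) * d by rewrite ler_wpM2r //; lra.
  by lra.
rewrite Dv in H.
have := ler_cabsD ('d f a v - 'd f ((1 - 4 * s ^+ 2)%:C%C *: a) v) ('d f ((1 - 4 * s ^+ 2)%:C%C *: a) v).
rewrite subrK => H2.
have H3 : cabs ('d f a v) * s <= (12 * (8 * M) / rho + cabs ('d f ((1 - 4 * s ^+ 2)%:C%C *: a) v)) * s.
  by rewrite ler_pM2r //; lra.
rewrite (le_trans H3) // mulrDl addrC lerD2l.
by rewrite /rho (_ : _ * s = 192 * (M * vnorm v)) //; field; rewrite !gt_eqF.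
Qed.

(** As [sigma] at least doubles at each step, [X = |'d f a v| sigma a] satisfies
    [X <= X' / 2 + 192 M |v|] with [X'] its value at the next point; 384 is the fixed constant of
    this recursion. It stops once [4 sigma ^ 2 >= 1], where the Bloch bound suffices. *)
Lemma tangential_bound a v : ball1 a -> ipE v a = 0 -> 0 <= M ->
  cabs ('d f a v) * sigma a <= 384 * (M * vnorm v).
Proof.
move=> + + M0.
have base b w : ball1 b -> 1 <= 4 * sigma b ^+ 2 ->
    cabs ('d f b w) * sigma b <= 384 * (M * vnorm w).
  move=> b1 sb; have s0 := sigma_gt0 b1.
  have sb2 : 1 <= 2 * sigma b by nra.
  have := f_bloch w b1; rewrite -sigma_sqr // => H.
  have M1 : 0 <= M * vnorm w by rewrite mulr_ge0 ?vnorm_ge0.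
  have c0 : 0 <= cabs ('d f b w) * sigma b by rewrite mulr_ge0 ?cabs_ge0 // ltW.
  have : cabs ('d f b w) * sigma b <= cabs ('d f b w) * sigma b * (2 * sigma b) by rewrite ler_peMr.
  by lra.
have ind n b w : ball1 b -> ipE w b = 0 -> 1 <= 4 ^+ n.+1 * sigma b ^+ 2 ->
    cabs ('d f b w) * sigma b <= 384 * (M * vnorm w).
  elim: n b => [|n IH] b b1 wb; first by rewrite expr1; exact: base.
  case: (leP 1 (4 * sigma b ^+ 2)) => [sb _|sb nb]; first exact: base.
  have s0 := sigma_gt0 b1; have sE := sigma_sqr b1.
  set s := sigma b in sb nb s0 sE *.
  have s20 : 0 < s ^+ 2 by rewrite exprn_gt0.
  pose c := (1 - 4 * s ^+ 2)%:C%C *: b.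
  have cE : vnorm c ^+ 2 = (1 - 4 * s ^+ 2) ^+ 2 * (1 - s ^+ 2).
    by rewrite /c vnormZ exprMn cabsR real_normK ?num_real // sE; congr (_ * _); ring.
  have c4 : 4 * s ^+ 2 <= 1 - vnorm c ^+ 2.
    rewrite cE -subr_ge0 (_ : _ - _ = s ^+ 2 * (1 - 4 * s ^+ 2) * (5 - 4 * s ^+ 2)); last by ring.
    by rewrite !mulr_ge0 ?(ltW s20) //; lra.
  have c1 : ball1 c by apply: ball1_of_sqr; lra.
  have sc := sigma_sqr c1; have sc0 := sigma_gt0 c1.
  have s2c : 2 * s <= sigma c.
    rewrite -(@ler_pXn2r _ 2) ?nnegrE ?mulr_ge0 ?(ltW s0) ?(ltW sc0) //.
    by rewrite exprMn sc; lra.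
  have wc : ipE w c = 0 by rewrite ipZr wb mulr0.
  have := IH c c1 wc; rewrite sc => /(_ _) IHc.
  have {}IHc : cabs ('d f c w) * sigma c <= 384 * (M * vnorm w).
    apply: IHc; rewrite (le_trans nb) // exprSr -mulrA ler_pM2l ?exprn_gt0 //.
  have := tangential_step b1 wb M0 (ltW sb); rewrite -/s -/c => H.
  have : cabs ('d f c w) * (2 * s) <= cabs ('d f c w) * sigma c by rewrite ler_wpM2l ?cabs_ge0.
  by lra.
move=> a1 va; have s20 : 0 < sigma a ^+ 2 by rewrite exprn_gt0 // sigma_gt0.
apply: (ind (Num.bound (sigma a ^+ 2)^-1)) => //.
rewrite -ler_pdivrMr // mul1r.
apply: (le_trans (ltW (archi_boundP _))); first by rewrite invr_ge0 ltW.
by rewrite -natrX ler_nat (leq_trans (ltnW (ltn_expl _ (isT : 1 < 4)%N))) // leq_exp2l.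
Qed.

(** The derivative of [mobius b] at 0 multiplies the part of [w] orthogonal to [b] by [- sigma b]
    and the part along [b] by [- sigma b ^ 2]. The tangential bound handles the first (384), the
    Bloch bound the second (1). *)
Lemma mobius_deriv_bound b w : ball1 b -> 0 <= M ->
  cabs ('d (f \o mobius ipE b) 0 w) <= 385 * M * vnorm w.
Proof.
move=> b1 M0; have y1 : ball1 (0 : E) by rewrite /ball1 /= vnorm0.
have dm : differentiable (mobius ipE b) 0 by exact: (@ex_diff _ _ _ _ _ _ _ (is_diff_mobius ipE b1 y1)).
rewrite diff_comp //=; last by rewrite mobius0; exact: f_an.
rewrite mobius0 diff_mobius0 //.
have s0 := sigma_gt0 b1; have sE := sigma_sqr b1.
have [u [z [wE ub [c zE] _ nw]]] := mobius_op_decomp ipE b w.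
have -> : mobius_op ipE b (ipE w b *: b - w) = - ((sigma b)%:C%C *: u + (sigma b ^+ 2)%:C%C *: z).
  have wb : ipE w b = c * (vnorm b ^+ 2)%:C%C.
    by rewrite wE ipDl ub add0r zE ipZl ip_vnorm.
  have -> : ipE w b *: b - w = - (u + (sigma b ^+ 2)%:C%C *: z).
    rewrite wb {1}wE zE sE rmorphB rmorph1 !scalerA !opprD addrCA; congr (_ + _).
    by rewrite -scalerBl -scaleNr; congr (_ *: _); ring.
  rewrite mobius_opN; congr (- _).
  have := mobius_op_linear ipE b 1 u ((sigma b ^+ 2)%:C%C *: z); rewrite !scale1r => ->.
  by rewrite mobius_op_perp // zE !mobius_opZ mobius_op_self.
rewrite linearN cabsN linearD (le_trans (ler_cabsD _ _)) // !cabs_linearZ !cabsR.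
have uw : vnorm u <= vnorm w.
  by rewrite -(@ler_pXn2r _ 2) ?nnegrE ?vnorm_ge0 // nw lerDl sqr_ge0.
have zw : vnorm z <= vnorm w.
  by rewrite -(@ler_pXn2r _ 2) ?nnegrE ?vnorm_ge0 // nw lerDr sqr_ge0.
have := tangential_bound b1 ub M0; have := f_bloch z b1; rewrite -sE.
rewrite !ger0_norm ?sqr_ge0 ?(ltW s0) //.
have Mu : M * vnorm u <= M * vnorm w by rewrite ler_wpM2l.
have Mz : M * vnorm z <= M * vnorm w by rewrite ler_wpM2l.
by lra.
Qed.

End Timoney.

(** * Operator norms, Bloch functions and pullbacks *)

Section BlochSpace.
Variables (R : realType) (E : normedModType R[i]) (ipE : inner_product E).
Implicit Types (f : E -> Cx R) (x h b w : E).

Lemma opnorm_ge0 (L : E -> Cx R) : (0 <= opnorm L)%E.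
Proof.
apply: (@le_trans _ _ (cabs (L 0))%:E); first by rewrite lee_fin cabs_ge0.
by apply: ereal_sup_ubound; exists 0 => //=; rewrite vnorm0.
Qed.

Lemma opnorm_le (L : E -> Cx R) (K : R) :
  (forall h, vnorm h <= 1 -> cabs (L h) <= K) -> (opnorm L <= K%:E)%E.
Proof. by move=> LK; apply: ge_ereal_sup => _ [h /= h1 <-]; rewrite lee_fin LK. Qed.

Lemma le_opnorm (L : {linear E -> Cx R}) (K : R) h :
  (opnorm L <= K%:E)%E -> cabs (L h) <= K * vnorm h.
Proof.
move=> LK; have [->|h0] := eqVneq h 0; first by rewrite linear0 cabs0 vnorm0 mulr0.
have nh : 0 < vnorm h by rewrite lt_def vnorm_ge0 vnorm_eq0 h0.
have : ((cabs (L ((vnorm h)^-1%:C%C *: h)))%:E <= K%:E)%E.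
  apply: (le_trans _ LK); apply: ereal_sup_ubound; exists ((vnorm h)^-1%:C%C *: h) => //=.
  by rewrite vnormZ cabsR ger0_norm ?invr_ge0 ?vnorm_ge0 // mulVf // gt_eqF.
rewrite lee_fin cabs_linearZ cabsR ger0_norm ?invr_ge0 ?vnorm_ge0 //.
by rewrite mulrC ler_pdivrMr.
Qed.

Lemma ball1_0 : ball1 (0 : E).
Proof. by rewrite /ball1 /= vnorm0. Qed.

Lemma inv_seminorm_ge0 f : (0 <= inv_seminorm ipE f)%E.
Proof.
apply: (@le_trans _ _ (opnorm ('d (f \o mobius ipE 0) 0))); first exact: opnorm_ge0.
by apply: ereal_sup_ubound; exists 0 => //; exact: ball1_0.
Qed.

Lemma bloch_space_bound f : bloch_space f -> exists2 M : R, 0 <= M &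
  forall x h, ball1 x -> (1 - vnorm x ^+ 2) * cabs ('d f x h) <= M * vnorm h.
Proof.
move=> [_ foo].
have f0 : (0 <= bloch_seminorm f)%E.
  apply: (@le_trans _ _ ((1 - vnorm (0 : E) ^+ 2)%:E * opnorm ('d f 0%R))%E).
    by rewrite mule_ge0 ?opnorm_ge0 // lee_fin vnorm0 expr0n subr0.
  by apply: ereal_sup_ubound; exists 0 => //; exact: ball1_0.
have fin : bloch_seminorm f \is a fin_num by rewrite ge0_fin_numE.
exists (fine (bloch_seminorm f)); first by rewrite fine_ge0.
move=> x h x1; have p0 : 0 < 1 - vnorm x ^+ 2 by rewrite subr_gt0 ball1_sqr.
rewrite mulrC -ler_pdivlMr // mulrAC [_ / _]mulrC; apply: le_opnorm.
rewrite EFinM fineK // lee_pdivlMl //.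
by apply: ereal_sup_ubound; exists x.
Qed.

Section Pullback.
Variables (f : E -> Cx R) (N : R).
Hypotheses (f_an : analytic_on_ball f) (N0 : 0 <= N).
Hypothesis fN : forall b w, ball1 b -> cabs ('d (f \o mobius ipE b) 0 w) <= N * vnorm w.

(** With [w] from [schwarz_pick] and [b = psi x], the chain rule used twice identifies the
    derivative of [f \o psi] along [v] with that of [f \o mobius b] at 0 along [w]. *)
Lemma diff_comp_bound (V : normedModType R[i]) (psi : V -> E) (x v : V) (rho : R) :
  0 < rho ->
  (forall l : R[i], cabs l < rho -> differentiable psi (x + l *: v)) ->
  (forall l : R[i], cabs l < rho -> ball1 (psi (x + l *: v))) ->
  cabs ('d (f \o psi) x v) <= N * (12 / rho).
Proof.
move=> rho0 dpsi psi1.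
have [w E1 wrho] := schwarz_pick ipE rho0 dpsi psi1.
have r00 : cabs (0 : R[i]) < rho by rewrite cabs0.
have b1 : ball1 (psi x) by have := psi1 _ r00; rewrite scale0r addr0.
have dx : differentiable psi x by have := dpsi _ r00; rewrite scale0r addr0.
have dm : differentiable (mobius ipE (psi x)) 0.
  exact: (@ex_diff _ _ _ _ _ _ _ (is_diff_mobius ipE b1 ball1_0)).
rewrite (diff_comp dx (f_an b1)) /= E1.
apply: (le_trans _ (ler_wpM2l N0 wrho)); apply: le_trans (fN w b1).
by rewrite (diff_comp dm) ?mobius0 //; exact: f_an.
Qed.

Lemma diff_bound x h : ball1 x -> vnorm h <= 1 ->
  forall phi : E -> E, analytic_on_ball phi -> (forall x, ball1 x -> ball1 (phi x)) ->
  cabs ('d (f \o phi) x h) <= N * (12 / (1 - vnorm x)).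
Proof.
move=> x1 h1 phi phi_an phi1.
have xl (l : R[i]) : cabs l < 1 - vnorm x -> ball1 (x + l *: h).
  move=> lx; rewrite /ball1 /= (le_lt_trans (ler_vnormD _ _)) // vnormZ.
  by have := ler_wpM2l (cabs_ge0 l) h1; lra.
by apply: diff_comp_bound => [|l /xl|l /xl]; [rewrite subr_gt0|exact: phi_an|exact: phi1].
Qed.

(** Mean value inequality on the segment from 0 to [b]; the derivative is bounded by
    [diff_comp_bound] for the identity, on discs of radius [1 - |b|]. *)
Lemma value_bound b : ball1 b -> cabs (f b - f 0) <= N * (12 / (1 - vnorm b)).
Proof.
move=> b1; have b1' : vnorm b < 1 by exact: b1.
have nb := vnorm_ge0 b.
have tb (t : R) (l : R[i]) : 0 <= t <= 1 -> cabs l < 1 - vnorm b ->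
    ball1 (0 + t%:C%C *: b + l *: b).
  move=> /andP[t0 t1] lb; rewrite /ball1 /= add0r (le_lt_trans (ler_vnormD _ _)) // !vnormZ.
  by rewrite cabsR ger0_norm //; nra.
have r00 : cabs (0 : R[i]) < 1 - vnorm b by rewrite cabs0 subr_gt0.
rewrite -[in f b](add0r b); apply: mean_value => t t01.
  by apply: f_an; have := tb t 0 t01 r00; rewrite scale0r addr0.
apply: (@diff_comp_bound _ id) => [|l _|l lb]; first by rewrite subr_gt0.
  exact: (@ex_diff _ _ _ _ _ _ _ (is_diff_id _)).
exact: tb.
Qed.

End Pullback.

End BlochSpace.

(** * Boundedness of composition operators *)

Theorem theorem4p1 (R : realType) (E : completeNormedModType R[i])
    (ipE : inner_product E) (phi : E -> E) :
  analytic_on_ball phi ->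
  (forall x : E, ball1 x -> ball1 (phi x)) ->
  exists K : R, 0 <= K /\
    forall f : E -> Cx R, bloch_space f ->
      bloch_space (f \o phi) /\
      (bloch_norm ipE (f \o phi) <= K%:E * bloch_norm ipE f)%E.
Proof.
move=> phi_an phi1; have b1 := phi1 _ (ball1_0 E).
pose b := phi 0; pose K0 := 12 / (1 - vnorm b).
have K00 : 0 <= K0 by rewrite divr_ge0 // subr_ge0 ltW //; exact: b1.
(* 12 bounds the seminorm of [f \o phi], [K0] the change of value from [f 0] to [f (phi 0)], and 1
   accounts for [f 0]. *)
exists (12 + K0 + 1); split; first by rewrite !addr_ge0.
move=> f fB; have [f_an _] := fB; split.
  have [M M0 fM] := bloch_space_bound fB; split.
    by move=> x x1; apply: differentiable_comp; [exact: phi_an | exact/f_an/phi1].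
  (* [(1 - |x| ^ 2) * 12 / (1 - |x|) = 12 (1 + |x|) <= 24]. *)
  apply: (@le_lt_trans _ _ (24 * (385 * M))%:E); last exact: ltry.
  apply: ge_ereal_sup => _ [x x1 <-].
  have x1' : vnorm x < 1 by exact: x1.
  have nx := vnorm_ge0 x.
  have p0 : 0 < 1 - vnorm x ^+ 2 by rewrite subr_gt0 ball1_sqr.
  have q0 : 0 < 1 - vnorm x by rewrite subr_gt0.
  have M385 : 0 <= 385 * M := mulr_ge0 (ler0n _ _) M0.
  have H : (opnorm ('d (f \o phi) x) <= (385 * M * (12 / (1 - vnorm x)))%:E)%E.
    apply: opnorm_le => h h1; apply: (diff_bound (ipE := ipE)) => // c w c1.
    exact: mobius_deriv_bound.
  apply: (@le_trans _ _ ((1 - vnorm x ^+ 2)%:E * (385 * M * (12 / (1 - vnorm x)))%:E)%E).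
    by apply: lee_wpmul2l => //; rewrite lee_fin ltW.
  rewrite -EFinM lee_fin.
  rewrite (_ : (1 - vnorm x ^+ 2) * _ = 12 * (1 + vnorm x) * (385 * M)).
    by rewrite ler_wpM2r //; lra.
  by move: (vnorm x) q0 (385 * M) => n q0 m; field; rewrite gt_eqF.
rewrite /bloch_norm.
have [foo|] := eqVneq (inv_seminorm ipE f) +oo%E.
  by rewrite foo addey // gt0_muley ?leey // lte_fin; lra.
rewrite -ltey => finv; have inv0 := inv_seminorm_ge0 ipE f.
have : inv_seminorm ipE f \is a fin_num by rewrite ge0_fin_numE.
move=> /fineK; set N := fine _ => NE.
have N0 : 0 <= N by rewrite fine_ge0.
have fN c w : ball1 c -> cabs ('d (f \o mobius ipE c) 0 w) <= N * vnorm w.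
  by move=> c1; apply: le_opnorm; rewrite NE; apply: ereal_sup_ubound; exists c.
rewrite -NE -EFinD -EFinM.
apply: (@le_trans _ _ ((cabs (f 0) + N * K0)%:E + (N * 12)%:E)%E).
  apply: leeD.
    rewrite lee_fin /=.
    have := value_bound f_an N0 fN b1; rewrite -/b -/K0.
    have := ler_cabsD (f b - f 0) (f 0); rewrite subrK.
    by move=> *; lra.
  apply: ge_ereal_sup => _ [x x1 <-]; apply: opnorm_le => h h1.
  (* Displays the constant as [12 / rho] with [rho = 1]: the disc of all [l *: h] with [|l| < 1]
     lies in the ball. *)
  rewrite -[12]divr1.
  have xl (l : R[i]) : cabs l < 1 -> ball1 (0 + l *: h).
    move=> l1; rewrite /ball1 /= add0r vnormZ.
    by have := cabs_ge0 l; have := vnorm_ge0 h; nra.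
  apply: (diff_comp_bound f_an N0 fN (psi := phi \o mobius ipE x)) => // l /xl l1.
    apply: differentiable_comp; last exact/phi_an/mobius_ball.
    exact: (@ex_diff _ _ _ _ _ _ _ (is_diff_mobius ipE x1 l1)).
  by apply: phi1; exact: mobius_ball.
rewrite -EFinD lee_fin.
have := cabs_ge0 (f 0); have := mulr_ge0 K00 (cabs_ge0 (f 0)).
by move=> *; nra.
Qed.
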